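(* For every $p\in(0.42,0.5)$ there exists $\gamma>0$ such that, as $t\to\infty$, \[ c_{t,t}\le \exp\left(\left(\frac{(4\log(1-p)-\log p)\,\log p}{8\log(1-p)}-\gamma\right)t^2+o(t^2)\right). \]
   Context: For integers $s,t\ge 1$, $c_{s,t}$ denotes the infimum, over all finite graphs $G$ containing no copy of the complete graph $K_t$, of the probability that $s$ independent uniformly random vertices $v_1,\dots,v_s\in V(G)$ (chosen with replacement, so repetitions are allowed) form an independent set in $G$, i.e. no two of them are adjacent. Here $\log$ is the natural logarithm. *)

(* Defs.v *)
From HB Require Import structures.
From mathcomp Require Import all_boot all_order all_algebra.
From mathcomp Require Import all_classical all_reals all_analysis.
Set Implicit Arguments. Unset Strict Implicit. Unset Printing Implicit Defensive.
Import Order.TTheory GRing.Theory Num.Theory.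
Local Open Scope ring_scope.
Local Open Scope classical_set_scope.

Definition simple_graph (n : nat) (e : rel 'I_n) : Prop :=
  symmetric e /\ irreflexive e.

Definition Kt_free (n : nat) (e : rel 'I_n) (t : nat) : Prop :=
  forall S : {set 'I_n}, #|S| = t ->
    exists x y, [/\ x \in S, y \in S, x != y & ~~ e x y].

Definition indep_prob {R : realType} (n : nat) (e : rel 'I_n) (s : nat) : R :=
  (#|[set v : {ffun 'I_s -> 'I_n} | [forall i, forall j, ~~ e (v i) (v j)]]|)%:R
  / ((n ^ s)%N)%:R.

Definition c_st {R : realType} (s t : nat) : R :=
  inf [set x : R | exists (n : nat) (e : rel 'I_n),
        [/\ (0 < n)%N, simple_graph e, Kt_free e t & x = indep_prob e s]].

(* Main.v *)
Require Import Defs.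
From HB Require Import structures.
From mathcomp Require Import all_boot all_order all_algebra.
From mathcomp Require Import all_classical all_reals all_analysis.
From mathcomp Require Import ring lra zify.
Import Order.TTheory GRing.Theory Num.Theory.
Set Implicit Arguments. Unset Strict Implicit. Unset Printing Implicit Defensive.
Local Open Scope ring_scope.

(** Write [L = - ln p], [M = - ln (1 - p)], [r = p / (1 - p)].  The exponent of the
    theorem without [gamma] is that of G(n,p) with n = exp(Lt/2), where independent
    [t]-tuples mostly have [k = (L / 2M) t] distinct entries.

    The improvement comes from a random geometric graph.  Every vertex gets a uniform
    label in {-1,1}^d with d = (Qt)^2, and an edge [uv] is kept with a probability close
    to p exp(- eps g - eps^2/2), where g = <x_u, x_v> / sqrt d.  As
    E[g_12 g_23 g_31] = 1 / sqrt d > 0, a [t]-clique becomes less likely by a factor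
    exp(- gain t^2) with gain = eps^3 / (6 Q), while an independent [k]-set becomes
    more likely only by a factor exp(gain (r k / t)^3 t^2).  So n can be multiplied by
    exp(gain t), and the count of independent tuples goes down as soon as
    (r k / t)^3 < 1 - k / t; this holds for all p in (0.42, 0.5).

    In expectations over the labels, vertices are averaged out one at a time.  For this,
    W (edge probability) and 1 - W are both dominated by p resp. 1 - p times a Gaussian
    weight exp(c + a g - b g^2), plus a term of size eps^4 controlling large [g]. *)

(** The gain is only of order eps^3 / Q per pair of vertices, so a pointwise error of order eps^3
    would destroy it and all estimates are exact through third order in eps. This forces the
    quadratic terms of the weights: a weight must have mean about 1, and without these terms
    normalised weights add up to less than 1 + r at g = 0. The expansion fails where eps |g| > 1.
    There the term of size eps^4 takes over, and it makes every weight a sum of three Gaussian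
    weights. A product over pairs then expands into products whose coefficients differ from pair to
    pair, which is why the moment bound treats arbitrary coefficients and not one constant. The
    dimension (Qt)^2 balances two demands: about t^3 / 6 triangles, each worth eps^3 / (Qt), must
    reach order t^2, and averaging out one vertex may change the coefficients of the other pairs
    only by O(1 / (Qt)), so that they stay bounded over t steps. The errors, relative to t^2, are of
    order eps^4 and eps^3 / Q^2, against the gain eps^3 / (6 Q); hence Q is taken large first, and
    then eps small depending on Q. *)

Definition avg {R : realType} {T : finType} (F : T -> R) : R :=
  (\sum_x F x) / #|T|%:R.

Definition upd {I T : finType} (f : {ffun I -> T}) (u : I) (y : T) :
  {ffun I -> T} := [ffun i => if i == u then y else f i].

(** * Uniform averages over finite types *)

Section Avg.
Variables (R : realType) (T : finType).
Implicit Types F G : T -> R.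

Lemma ler_avg F G : (forall x, F x <= G x) -> avg F <= avg G.
Proof. by move=> h; apply: ler_wpM2r; rewrite ?invr_ge0 ?ler0n // ler_sum. Qed.

Lemma eq_avg F G : F =1 G -> avg F = avg G.
Proof. by move=> h; congr (_ / _); apply: eq_bigr => x _. Qed.

Lemma avgD F G : avg (fun x => F x + G x) = avg F + avg G.
Proof. by rewrite /avg big_split mulrDl. Qed.

Lemma avgZ (c : R) F : avg (fun x => c * F x) = c * avg F.
Proof. by rewrite /avg -mulr_sumr mulrA. Qed.

Lemma avg_sum (J : Type) (r : seq J) (P : pred J) (F : J -> T -> R) :
  avg (fun x => \sum_(j <- r | P j) F j x) = \sum_(j <- r | P j) avg (F j).
Proof. by rewrite /avg exchange_big mulr_suml. Qed.

Lemma avg_const (c : R) : (0 < #|T|)%N -> avg (fun _ : T => c) = c.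
Proof.
move=> h; rewrite /avg sumr_const -[c *+ _]mulr_natr mulfK //.
by rewrite pnatr_eq0 -lt0n.
Qed.
End Avg.

Lemma avg_bool (R : realType) (F : bool -> R) : avg F = (F true + F false) / 2.
Proof. by rewrite /avg card_bool big_bool. Qed.

Lemma upd_same (I T : finType) (f : {ffun I -> T}) u y : upd f u y u = y.
Proof. by rewrite ffunE eqxx. Qed.

Lemma upd_other (I T : finType) (f : {ffun I -> T}) u y i :
  i != u -> upd f u y i = f i.
Proof. by rewrite ffunE => /negPf ->. Qed.

(** Resampling the coordinate [u] preserves the uniform measure: exchanging the new value with the
    old one is an involution on pairs (function, value). *)
Lemma avg_upd (R : realType) (I T : finType) (F : {ffun I -> T} -> R) (u : I) :
  (0 < #|T|)%N -> avg F = avg (fun f => avg (fun y => F (upd f u y))).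
Proof.
move=> T0; rewrite /avg -mulr_suml; congr (_ / _).
have -> : \sum_f \sum_y F (upd f u y)
          = \sum_(z : {ffun I -> T} * T) F (upd z.1 u z.2).
  by rewrite pair_bigA.
pose h (z : {ffun I -> T} * T) := (upd z.1 u z.2, z.1 u).
have hK : involutive h.
  move=> [f y]; rewrite /h /= upd_same; congr (_, _).
  by apply/ffunP => i; rewrite !ffunE; case: eqP => // ->.
rewrite (reindex_inj (inv_inj hK)) /=.
transitivity (\sum_(f : {ffun I -> T}) \sum_(y : T) F f / #|T|%:R).
  apply: eq_bigr => f _; rewrite sumr_const -[_ *+ _]mulr_natr mulfVK //.
  by rewrite pnatr_eq0 -lt0n.
rewrite pair_bigA /= mulr_suml; apply: eq_bigr => [[f y]] _ /=.
by have /(congr1 fst) /= -> := hK (f, y).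
Qed.

(** * Random signs *)

Definition sgn {R : realType} (b : bool) : R := if b then 1 else -1.

Lemma sgn2 (R : realType) b : sgn b * sgn b = 1 :> R.
Proof. by case: b; rewrite /sgn; ring. Qed.

Section Cosh.
Import numFieldNormedType.Exports.
Local Open Scope classical_set_scope.

(** The series are compared term by term: odd terms cancel, and 2^n n! <= (2n)! for the even ones.
    Hence [n.*2] terms on the left go with [n] terms on the right. *)
Lemma coshr_le (R : realType) (u : R) :
  (expR u + expR (- u)) / 2 <= expR (u ^+ 2 / 2).
Proof.
have SS n : (series (exp_coeff u) n.*2 + series (exp_coeff (- u)) n.*2) / 2
      <= series (exp_coeff (u ^+ 2 / 2)) n.
  rewrite /series /= -big_split /= mulr_suml.
  elim: n => [|n IH]; first by rewrite !big_geq.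
  rewrite doubleS !big_nat_recr //= -addrA lerD //.
  rewrite /exp_coeff /=.
  have -> : (- u) ^+ (n.*2).+1 = - u ^+ (n.*2).+1.
    by rewrite exprNn -signr_odd /= odd_double expr1 mulN1r.
  have -> : (- u) ^+ (n.*2) = u ^+ (n.*2).
    by rewrite exprNn -signr_odd /= odd_double expr0 mul1r.
  rewrite mulNr subrr mul0r addr0.
  have -> (z : R) : (z + z) / 2 = z by lra.
  have -> : u ^+ n.*2 = (u ^+ 2) ^+ n by rewrite -mul2n exprM.
  rewrite expr_div_n -mulrA; apply: ler_wpM2l.
    by rewrite exprn_ge0 // sqr_ge0.
  rewrite -invfM lef_pV2 ?posrE ?mulr_gt0 ?exprn_gt0 ?ltr0n ?fact_gt0 //.
  rewrite -natrX -natrM ler_nat.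
  elim: n {IH} => [//|n IH].
  rewrite doubleS !factS expnS; apply: (@leq_trans (n.*2.+2 * (2 ^ n * n`!))).
    by rewrite -mul2n; nia.
  by rewrite leq_mul2l /= (leq_trans IH) // leq_pmull.
have dbl : n.*2 @[n --> \oo] --> \oo.
  move=> A [N _ hA]; exists N => // n /= Nn; apply: hA => /=.
  by rewrite (leq_trans Nn) // -addnn leq_addr.
have cv (x : R) : series (exp_coeff x) n.*2 @[n --> \oo] --> (expR x : R^o).
  exact: cvg_comp dbl (is_cvg_series_exp_coeff x).
have cv2 : (series (exp_coeff u) n.*2 + series (exp_coeff (- u)) n.*2) / 2
    @[n --> \oo] --> ((expR u + expR (- u)) / 2 : R^o).
  by apply: cvgMl; apply: cvgD; exact: cv.
apply: ler_cvg_to cv2 (is_cvg_series_exp_coeff (u ^+ 2 / 2)) _.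
by near=> n; exact: SS.
Unshelve. all: by end_near.
Qed.
End Cosh.

(** * Exponential moments of quadratic forms in random signs *)

Section Quadratic.
Variables (R : realType) (I : finType).
Implicit Types (r : seq I) (X : I -> I -> R) (y : I -> R).

Definition qf r X y := \sum_(i <- r) \sum_(j <- r) X i j * (y i * y j).

Lemma eq_qf r X y z : {in r, y =1 z} -> qf r X y = qf r X z.
Proof.
move=> yz; apply: eq_big_seq => i ir; apply: eq_big_seq => j jr.
by rewrite !yz.
Qed.

Lemma qf_cons l r X y : (forall i j, X i j = X j i) ->
  qf (l :: r) X y
  = X l l * y l ^+ 2 + 2 * y l * (\sum_(j <- r) X l j * y j) + qf r X y.
Proof.
move=> sX; rewrite /qf big_cons big_cons.
under [X in _ + X = _]eq_bigr do rewrite big_cons.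
rewrite big_split /= !addrA; congr (_ + _).
rewrite -addrA expr2; congr (_ + _).
rewrite [in RHS]mulr_sumr -big_split /=; apply: eq_bigr => j _.
by rewrite (sX j l); ring.
Qed.

Lemma qf_sqr r (w y : I -> R) (c : R) :
  qf r (fun i j => c * (w i * w j)) y = c * (\sum_(i <- r) w i * y i) ^+ 2.
Proof.
rewrite /qf expr2 mulr_suml mulr_sumr; apply: eq_bigr => i _.
rewrite mulr_sumr mulr_sumr; apply: eq_bigr => j _; ring.
Qed.

Lemma qfB r X1 X2 y :
  qf r (fun i j => X1 i j - X2 i j) y = qf r X1 y - qf r X2 y.
Proof.
rewrite /qf -sumrB; apply: eq_bigr => i _; rewrite -sumrB.
by apply: eq_bigr => j _; ring.
Qed.

(* Eliminating one coordinate with [cosh u <= exp (u^2/2)] turns the quadratic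
   form [I + X] into its Schur complement, exactly as for a Gaussian vector. *)
Lemma rademacher_quadratic (del : R) : 0 < del -> del <= 1 / 4 ->
  forall r, uniq r -> forall X (th : I -> R) (T : R),
  (forall i j, X i j = X j i) ->
  (forall i, X i i <= 0) ->
  (forall y, 0 <= qf r X y + del * \sum_(i <- r) y i ^+ 2) ->
  (forall y, 2 * (\sum_(i <- r) th i * y i)
             - (qf r X y + \sum_(i <- r) y i ^+ 2) <= T) ->
  avg (fun f : {ffun I -> bool} =>
         expR (\sum_(i <- r) th i * sgn (f i) - qf r X (fun i => sgn (f i)) / 2))
  <= expR (T / 2 - (\sum_(i <- r) X i i) / 2
           + (\sum_(i <- r) \sum_(j <- r) X i j ^+ 2) / 2).
Proof.
(* [T] plays the role of th^T (I + X)^-1 th, given by its variational form so that no inverse matrix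
   occurs. The two other terms of the bound replace - log det (I + X) / 2. *)
move=> d0 d4; elim=> [_|l r IH /= /andP[lr ur]] X th T sX dX psd hT.
  under eq_avg do rewrite big_nil /qf big_nil mul0r subrr expR0.
  rewrite avg_const; last by rewrite card_ffun expn_gt0 card_bool.
  have := hT (fun=> 0); rewrite /qf !big_nil => T0.
  by rewrite -[leLHS]expR0 ler_expR; lra.
have ext (z : R) (y : I -> R) :
    [/\ \sum_(i <- l :: r) (if i == l then z else y i) ^+ 2
        = z ^+ 2 + \sum_(i <- r) y i ^+ 2,
      \sum_(i <- l :: r) th i * (if i == l then z else y i)
        = th l * z + \sum_(i <- r) th i * y i &
      qf (l :: r) X (fun i => if i == l then z else y i)
      = X l l * z ^+ 2 + 2 * z * (\sum_(j <- r) X l j * y j) + qf r X y].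
  rewrite !big_cons eqxx qf_cons // eqxx.
  have nl i : i \in r -> (i == l) = false.
    by move=> ir; apply/negP => /eqP il; rewrite il (negPf lr) in ir.
  split; [congr (_ + _)|congr (_ + _)|congr (_ + _)].
  - by apply: eq_big_seq => i /nl ->.
  - by apply: eq_big_seq => i /nl ->.
  - by congr (_ + _ * _); apply: eq_big_seq => i /nl ->.
  - by apply: eq_qf => i /nl ->.
set S := 1 + X l l; set w := X l.
set W2 := \sum_(i <- r) w i ^+ 2.
have W20 : 0 <= W2 by apply: sumr_ge0 => i _; exact: sqr_ge0.
have psd' z y : 0 <= X l l * z ^+ 2 + 2 * z * (\sum_(j <- r) w j * y j)
    + qf r X y + del * (z ^+ 2 + \sum_(i <- r) y i ^+ 2).
  by have := psd (fun i => if i == l then z else y i); have [-> _ ->] := ext z y.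
have hT' z y : 2 * (th l * z + \sum_(i <- r) th i * y i)
    - (X l l * z ^+ 2 + 2 * z * (\sum_(j <- r) w j * y j)
    + qf r X y + (z ^+ 2 + \sum_(i <- r) y i ^+ 2)) <= T.
  by have := hT (fun i => if i == l then z else y i); have [-> -> ->] := ext z y.
have Xl : 0 <= X l l + del.
  have := psd' 1 (fun=> 0).
  rewrite /qf !big1; [lra|by move=> *; rewrite expr0n|move=> i _|by move=> *; rewrite mulr0].
  by rewrite big1 // => j _; rewrite !mulr0.
have Xl0 := dX l.
have S34 : 3 / 4 <= S by rewrite /S; lra.
have S1 : S <= 1 by rewrite /S; lra.
have S0 : 0 < S by lra.
have XwE : \sum_(j <- r) w j * w j = W2 by apply: eq_bigr => i _; rewrite expr2.
(* The first coordinate [- W2 / del] minimises 2 z W2 + del z^2, the part of the form at (z, w) in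
   which only [X l l] is left out. *)
have Qw : W2 ^+ 2 / del - del * W2 <= qf r X w.
  have := psd' (- W2 / del) w; rewrite XwE -/W2.
  have -> : X l l * (- W2 / del) ^+ 2 + 2 * (- W2 / del) * W2 + qf r X w
     + del * ((- W2 / del) ^+ 2 + W2)
     = X l l * (W2 / del) ^+ 2 - W2 ^+ 2 / del + qf r X w + del * W2.
    by field; rewrite gt_eqF.
  have : X l l * (W2 / del) ^+ 2 <= 0 by rewrite mulr_le0_ge0 // sqr_ge0.
  lra.
(* The same choice of first coordinate for general [y]. Since [del <= S], the Schur complement
   inherits the lower bound with the same [del], which the induction needs. *)
have Qy y : (\sum_(j <- r) w j * y j) ^+ 2 / S
    <= qf r X y + del * \sum_(i <- r) y i ^+ 2.
  set m := \sum_(j <- r) w j * y j.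
  have := psd' (- m / del) y; rewrite -/m.
  have -> : X l l * (- m / del) ^+ 2 + 2 * (- m / del) * m + qf r X y
     + del * ((- m / del) ^+ 2 + \sum_(i <- r) y i ^+ 2)
     = X l l * (m / del) ^+ 2 - m ^+ 2 / del
       + (qf r X y + del * \sum_(i <- r) y i ^+ 2).
    by field; rewrite gt_eqF.
  have h1 : X l l * (m / del) ^+ 2 <= 0 by rewrite mulr_le0_ge0 // sqr_ge0.
  have h2 : m ^+ 2 / S <= m ^+ 2 / del.
    apply: ler_wpM2l; first exact: sqr_ge0.
    by rewrite lef_pV2 ?posrE //; lra.
  lra.
(* I + X' is the Schur complement of the entry [S] in I + X, and [th'] is the linear term left after
   eliminating coordinate [l]. *)
pose X' i j := X i j - S^-1 * (w i * w j).
pose th' i := th i - th l / S * w i.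
have qX' y : qf r X' y = qf r X y - S^-1 * (\sum_(i <- r) w i * y i) ^+ 2.
  by rewrite /X' qfB qf_sqr.
have th'E y : \sum_(i <- r) th' i * y i
    = \sum_(i <- r) th i * y i - th l / S * \sum_(i <- r) w i * y i.
  by rewrite mulr_sumr -sumrB; apply: eq_bigr => i _; rewrite /th'; ring.
have IH' : avg (fun f : {ffun I -> bool} =>
    expR (\sum_(i <- r) th' i * sgn (f i) - qf r X' (fun i => sgn (f i)) / 2))
  <= expR ((T - th l ^+ 2 / S) / 2 - (\sum_(i <- r) X' i i) / 2
           + (\sum_(i <- r) \sum_(j <- r) X' i j ^+ 2) / 2).
  apply: IH => //.
  - by move=> i j; rewrite /X' sX; ring.
  - move=> i; rewrite /X'.
    have : 0 <= S^-1 * (w i * w i) by rewrite -expr2 mulr_ge0 ?sqr_ge0 // invr_ge0 ltW.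
    by have := dX i; lra.
  - by move=> y; rewrite qX'; have := Qy y; rewrite [_ / S]mulrC; lra.
  move=> y; rewrite qX' th'E.
  set m := \sum_(j <- r) w j * y j.
  (* The maximiser over the eliminated coordinate; its value takes th_l^2 / S out of [T]. *)
  have := hT' ((th l - m) / S) y; rewrite -/m.
  set A := \sum_(i <- r) th i * y i; set B := qf r X y; set C := \sum_(i <- r) _.
  have -> : X l l = S - 1 by rewrite /S; ring.
  suff -> : 2 * (th l * ((th l - m) / S) + A)
     - ((S - 1) * ((th l - m) / S) ^+ 2 + 2 * ((th l - m) / S) * m + B
        + (((th l - m) / S) ^+ 2 + C))
     = 2 * (A - th l / S * m) - (B - S^-1 * m ^+ 2 + C) + th l ^+ 2 / S by lra.
  by field; rewrite gt_eqF.
rewrite (avg_upd _ l) ?card_bool //.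
apply: (@le_trans _ _ (avg (fun f : {ffun I -> bool} =>
  expR (- X l l / 2 + th l ^+ 2 / (2 * S)) *
  expR (\sum_(i <- r) th' i * sgn (f i) - qf r X' (fun i => sgn (f i)) / 2)))).
  apply: ler_avg => f; rewrite avg_bool.
  set m := \sum_(j <- r) w j * sgn (f j).
  set A := \sum_(i <- r) th i * sgn (f i).
  set B := qf r X (fun i => sgn (f i)).
  have E b : \sum_(i <- l :: r) th i * sgn (upd f l b i)
      - qf (l :: r) X (fun i => sgn (upd f l b i)) / 2
      = (A - X l l / 2 - B / 2) + sgn b * (th l - m).
    have [_ e1 e2] := ext (sgn b) (fun i => sgn (f i)).
    have eS i : sgn (upd f l b i) = if i == l then sgn b else sgn (f i) :> R.
      by rewrite ffunE; case: eqP.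
    under eq_bigr do rewrite eS.
    have -> : qf (l :: r) X (fun i => sgn (upd f l b i))
        = qf (l :: r) X (fun i => if i == l then sgn b else sgn (f i)).
      by apply: eq_qf => i _; exact: eS.
    by rewrite e1 e2 -/A -/B -/m expr2 sgn2; field.
  rewrite !E; set base := A - X l l / 2 - B / 2.
  rewrite !(expRD base) /= mul1r mulN1r -mulrDr -mulrA.
  apply: le_trans (_ : _ <= expR base * expR ((th l - m) ^+ 2 / 2)) _.
    by apply: ler_wpM2l; rewrite ?expR_ge0 // coshr_le.
  rewrite -!expRD ler_expR qX' th'E -/m -/A -/B.
  (* A sign has variance 1 where the Gaussian would have 1 / S. The sign bound is the smaller one
     because [S <= 1], that is, because the diagonal of [X] is nonpositive. *)
  have h : (th l - m) ^+ 2 <= (th l - m) ^+ 2 / S.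
    by rewrite ler_peMr ?sqr_ge0 // invf_ge1.
  have -> : - X l l / 2 + th l ^+ 2 / (2 * S)
     + (A - th l / S * m - (B - S^-1 * m ^+ 2) / 2)
     = A - X l l / 2 - B / 2 + ((th l - m) ^+ 2 / S) / 2.
    by field; rewrite gt_eqF.
  by rewrite lerD2l ler_pM2r // invr_gt0.
rewrite avgZ; apply: le_trans (ler_wpM2l (expR_ge0 _) IH') _; clear IH IH'.
rewrite -expRD ler_expR.
have trX' : \sum_(i <- r) X' i i = \sum_(i <- r) X i i - W2 / S.
  rewrite /W2 mulr_suml -sumrB; apply: eq_bigr => i _; rewrite /X'; ring.
have nX' : \sum_(i <- r) \sum_(j <- r) X' i j ^+ 2
   = \sum_(i <- r) \sum_(j <- r) X i j ^+ 2 - 2 / S * qf r X w + W2 ^+ 2 / S ^+ 2.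
  have -> : W2 ^+ 2 / S ^+ 2 = qf r (fun i j => S^-2 * (w i * w j)) w.
    by rewrite qf_sqr XwE mulrC.
  rewrite /qf mulr_sumr -sumrB -big_split /=; apply: eq_bigr => i _.
  rewrite mulr_sumr -sumrB -big_split /=; apply: eq_bigr => j _.
  by rewrite /X' -exprVn; ring.
have nX : \sum_(i <- l :: r) \sum_(j <- l :: r) X i j ^+ 2
   = X l l ^+ 2 + 2 * W2 + \sum_(i <- r) \sum_(j <- r) X i j ^+ 2.
  rewrite big_cons big_cons.
  under [X in _ + X = _]eq_bigr do rewrite big_cons.
  rewrite big_split /=.
  under [X in _ + (X + _) = _]eq_bigr do rewrite sX.
  by rewrite -/W2; ring.
rewrite trX' nX' nX big_cons.
set N := \sum_(i <- r) \sum_(j <- r) _; set t := \sum_(i <- r) _; set q := qf r X w.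
have -> : th l ^+ 2 / (2 * S) = th l ^+ 2 / S / 2 by field; rewrite gt_eqF.
set th2 := th l ^+ 2 / S.
(* Row and column [l] add 2 W2 to the squared Frobenius norm. This pays for the trace lost in [X']
   (W2 / S) and for the change of the remaining block, where [Qw] bounds [q] from below. *)
suff : W2 / S - 2 / S * q + W2 ^+ 2 / S ^+ 2 <= 2 * W2.
  by have := sqr_ge0 (X l l); lra.
have -> : W2 / S - 2 / S * q + W2 ^+ 2 / S ^+ 2 = (W2 - 2 * q + W2 ^+ 2 / S) / S.
  by field; rewrite gt_eqF.
rewrite ler_pdivrMr //.
have : W2 ^+ 2 / S <= 2 * (W2 ^+ 2 / del).
  rewrite mulrCA; apply: ler_wpM2l; first exact: sqr_ge0.
  rewrite -[leLHS]mul1r ler_pdivrMr // -mulrA mulrC -mulrA.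
  rewrite ler_pdivlMl //; nra.
move: Qw; rewrite -/q.
have : del * W2 <= 1 / 4 * W2 by apply: ler_wpM2r.
have : 3 / 4 * W2 <= S * W2 by apply: ler_wpM2r.
lra.
Qed.
End Quadratic.

(** * Pairs of entries of a sequence *)

Section Pairs.
Variable V : eqType.

(** Each unordered pair occurs once, grouped by its earlier entry: peeling off the head removes
    exactly the pairs of the vertex that is averaged out next. *)
Fixpoint pairs (s : seq V) : seq (V * V) :=
  if s is u :: s' then [seq (u, i) | i <- s'] ++ pairs s' else [::].

Lemma sum_pairs_cons (R : realType) u s (F : V * V -> R) :
  \sum_(z <- pairs (u :: s)) F z
  = \sum_(i <- s) F (u, i) + \sum_(z <- pairs s) F z.
Proof. by rewrite /= big_cat big_map. Qed.

Lemma size_pairs s : size (pairs s) = 'C(size s, 2).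
Proof.
elim: s => //= u s IH.
by rewrite size_cat size_map IH binS bin1 addnC.
Qed.

Lemma mem_pairs s z : z \in pairs s -> z.1 \in s /\ z.2 \in s.
Proof.
elim: s => //= u s IH; rewrite mem_cat => /orP[/mapP[i si ->] /=|/IH[h1 h2]].
  by rewrite !inE eqxx si orbT.
by rewrite !inE h1 h2 !orbT.
Qed.

Lemma uniq_pairs s : uniq s -> uniq (pairs s).
Proof.
elim: s => //= u s IH /andP[us ss].
rewrite cat_uniq IH // andbT map_inj_uniq ?ss => [|i j [] //].
apply/hasPn => -[i j] /mem_pairs[/= iI _]; apply/mapP => -[k _ [iu _]].
by rewrite -iu iI in us.
Qed.

Lemma sum_sym_pairs (R : realType) s (H : V -> V -> R) :
  (forall i j, H i j = H j i) ->
  \sum_(i <- s) \sum_(j <- s) H i j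
  = \sum_(i <- s) H i i + 2 * \sum_(z <- pairs s) H z.1 z.2.
Proof.
move=> sH; elim: s => [|u s IH]; first by rewrite !big_nil; ring.
rewrite sum_pairs_cons !big_cons.
under [X in _ + X = _]eq_bigr do rewrite big_cons.
rewrite big_split /= IH.
under [X in _ + (X + _) = _]eq_bigr do rewrite sH.
ring.
Qed.

(** Each entry lies in size s - 1 pairs. *)
Lemma sum_pairs_add (R : realType) s (e : V -> R) : (forall i, 0 <= e i) ->
  \sum_(z <- pairs s) (e z.1 + e z.2) <= (size s)%:R * \sum_(i <- s) e i.
Proof.
move=> e0; elim: s => [|u s IH]; first by rewrite !big_nil mulr0.
rewrite sum_pairs_cons big_cons big_split /=.
have -> : \sum_(i <- s) e u = (size s)%:R * e u.
  by rewrite big_const_seq count_predT iter_addr_0 mulr_natl.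
rewrite -natr1.
have : 0 <= \sum_(i <- s) e i by apply: sumr_ge0.
have := e0 u; lra.
Qed.
End Pairs.

(** * Averaging out the label of one vertex *)

Section Gram.
Variables (R : realType) (D : finType) (rho : R).
Hypothesis rho0 : 0 < rho.
Hypothesis rhoD : rho ^+ 2 * #|D|%:R = 1.
Local Notation label := {ffun D -> bool}.

(** By [rhoD], rho = 1 / sqrt d, so this is the normalised product g of order 1; the diagonal value
    [gram x x] is 1 / rho. *)
Definition gram (x y : label) : R := rho * \sum_l sgn (x l) * sgn (y l).

Lemma gramC x y : gram x y = gram y x.
Proof. by congr (_ * _); apply: eq_bigr => l _; rewrite mulrC. Qed.

Lemma gram_diag x : rho * gram x x = 1.
Proof.
rewrite /gram mulrA -expr2 -rhoD; congr (_ * _).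
by under eq_bigr do rewrite sgn2; rewrite sumr_const.
Qed.

(** The exponent is a quadratic polynomial in the signs of [y]. The square of its linear part
    produces the products a_i a_j g_ij, and the Frobenius norm of its quadratic part the products
    b_i b_j g_ij^2. So the bound has again the form of a Gaussian weight, now on pairs of the
    remaining vertices, and the step can be iterated. *)
Lemma gram_step (V : eqType) (s : seq V) (x : V -> label) (a b : V -> R) (del : R) :
  0 < del -> del <= 1 / 4 -> (forall i, 0 <= b i) ->
  2 * rho ^+ 2 * (\sum_(i <- s) b i) <= del ->
  avg (fun y : label =>
    expR (\sum_(i <- s) (a i * gram (x i) y - b i * gram (x i) y ^+ 2)))
  <= expR (\sum_(i <- s) ((1 - del)^-1 / 2 * a i ^+ 2 - b i + 2 * b i ^+ 2)
     + \sum_(z <- pairs s)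
         ((1 - del)^-1 * rho * (a z.1 * a z.2) * gram (x z.1) (x z.2)
          + 4 * rho ^+ 2 * (b z.1 * b z.2) * gram (x z.1) (x z.2) ^+ 2)).
Proof.
move=> d0 d4 b0 bd.
set h := (1 - del)^-1.
pose r := index_enum D.
pose X0 l l' := 2 * rho ^+ 2 * \sum_(i <- s) b i * (sgn (x i l) * sgn (x i l')).
(* The diagonal of [X0] is constant and multiplies y_l^2 = 1, so it is split off as the constant -
   sum b_i. The rest has zero trace and is bounded below by - c. *)
pose X l l' := if l == l' then 0 else X0 l l'.
pose th l := rho * \sum_(i <- s) a i * sgn (x i l).
pose c := 2 * rho ^+ 2 * \sum_(i <- s) b i.
have qX y : qf r X y = 2 * rho ^+ 2 * (\sum_(i <- s) b i * (\sum_l sgn (x i l) * y l) ^+ 2)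
    - c * \sum_l y l ^+ 2.
  have -> : 2 * rho ^+ 2 * (\sum_(i <- s) b i * (\sum_l sgn (x i l) * y l) ^+ 2)
     = \sum_l \sum_l' X0 l l' * (y l * y l').
    transitivity (\sum_(i <- s) 2 * rho ^+ 2 *
       (\sum_l \sum_l' (b i * (sgn (x i l) * sgn (x i l'))) * (y l * y l'))).
      rewrite mulr_sumr; apply: eq_bigr => i _; congr (_ * _).
      rewrite expr2 mulr_suml mulr_sumr; apply: eq_bigr => l _.
      by rewrite mulr_sumr mulr_sumr; apply: eq_bigr => l' _; ring.
    rewrite -mulr_sumr exchange_big mulr_sumr; apply: eq_bigr => l _.
    rewrite exchange_big mulr_sumr; apply: eq_bigr => l' _.
    by rewrite /X0 -mulr_suml mulrA.
  rewrite mulr_sumr /qf -sumrB; apply: eq_bigr => l _.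
  rewrite (bigD1 l) //= [X in _ = X - _](bigD1 l) //= /X eqxx mul0r add0r.
  have -> : X0 l l = c.
    by rewrite /X0; under eq_bigr do rewrite sgn2 mulr1.
  rewrite expr2 [X in _ = X - _]addrC addrK.
  by apply: eq_bigr => l' l'l; rewrite eq_sym (negPf l'l).
have psd y : 0 <= qf r X y + del * \sum_(l <- r) y l ^+ 2.
  rewrite qX.
  have : 0 <= 2 * rho ^+ 2 * (\sum_(i <- s) b i * (\sum_l sgn (x i l) * y l) ^+ 2).
    apply: mulr_ge0; first by rewrite mulr_ge0 ?exprn_ge0 // ltW.
    by apply: sumr_ge0 => i _; rewrite mulr_ge0 // sqr_ge0.
  have : c * \sum_l y l ^+ 2 <= del * \sum_l y l ^+ 2.
    by apply: ler_wpM2r => //; apply: sumr_ge0 => l _; exact: sqr_ge0.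
  rewrite -/r; lra.
have dotE i (y : label) : \sum_l sgn (x i l) * sgn (y l) = gram (x i) y / rho.
  by rewrite /gram mulrC mulKf // gt_eqF.
have expE (y : label) : \sum_(i <- s) (a i * gram (x i) y - b i * gram (x i) y ^+ 2)
   = (\sum_(l <- r) th l * sgn (y l) - qf r X (fun l => sgn (y l)) / 2)
     + - \sum_(i <- s) b i.
  rewrite qX.
  have -> : \sum_l (sgn (y l) : R) ^+ 2 = #|D|%:R.
    by under eq_bigr do rewrite expr2 sgn2; rewrite sumr_const.
  have -> : c * #|D|%:R = 2 * \sum_(i <- s) b i.
    by rewrite /c mulrAC -[2 * _ * _]mulrA rhoD mulr1.
  have -> : \sum_(l <- r) th l * sgn (y l) = \sum_(i <- s) a i * gram (x i) y.
    under eq_bigr do rewrite /th mulr_sumr mulr_suml.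
    rewrite exchange_big; apply: eq_bigr => i _.
    by rewrite /gram mulr_sumr mulr_sumr; apply: eq_bigr => l _; ring.
  have -> : 2 * rho ^+ 2 * (\sum_(i <- s) b i * (\sum_l sgn (x i l) * sgn (y l)) ^+ 2)
     = 2 * \sum_(i <- s) b i * gram (x i) y ^+ 2.
    rewrite -mulrA; congr (_ * _); rewrite mulr_sumr; apply: eq_bigr => i _.
    by rewrite dotE; field; rewrite gt_eqF.
  rewrite sumrB; lra.
have thE : \sum_(l <- r) th l ^+ 2 = \sum_(i <- s) a i ^+ 2
     + 2 * \sum_(z <- pairs s) rho * (a z.1 * a z.2) * gram (x z.1) (x z.2).
  transitivity (\sum_(i <- s) \sum_(j <- s) rho * (a i * a j) * gram (x i) (x j)).
    under eq_bigr do rewrite /th exprMn [(\sum_(i <- s) _) ^+ 2]expr2 mulr_suml mulr_sumr.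
    rewrite exchange_big; apply: eq_bigr => i _.
    under eq_bigr do rewrite !mulr_sumr.
    rewrite exchange_big; apply: eq_bigr => j _.
    by rewrite /gram !mulr_sumr; apply: eq_bigr => l _; ring.
  rewrite sum_sym_pairs; last by move=> i j; rewrite gramC; ring.
  congr (_ + _); apply: eq_bigr => i _.
  by rewrite mulrAC gram_diag mul1r expr2.
have nX : \sum_(l <- r) \sum_(l' <- r) X l l' ^+ 2 <= 4 * \sum_(i <- s) b i ^+ 2
     + 8 * \sum_(z <- pairs s) rho ^+ 2 * (b z.1 * b z.2) * gram (x z.1) (x z.2) ^+ 2.
  apply: (@le_trans _ _ (\sum_l \sum_l' X0 l l' ^+ 2)).
    apply: ler_sum => l _; apply: ler_sum => l' _; rewrite /X.
    by case: eqP => // _; rewrite expr0n sqr_ge0.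
  rewrite le_eqVlt; apply/orP; left; apply/eqP.
  transitivity (4 * \sum_(i <- s) \sum_(j <- s)
      rho ^+ 2 * (b i * b j) * gram (x i) (x j) ^+ 2).
    transitivity (\sum_(i <- s) \sum_(j <- s) \sum_l \sum_l'
       4 * rho ^+ 4 * (b i * b j) *
       ((sgn (x i l) * sgn (x j l)) * (sgn (x i l') * sgn (x j l')))).
      under eq_bigr do under eq_bigr do rewrite /X0 exprMn [(\sum_(i <- s) _) ^+ 2]expr2 mulr_suml mulr_sumr.
      under eq_bigr do rewrite exchange_big.
      rewrite exchange_big; apply: eq_bigr => i _.
      under eq_bigr do under eq_bigr do rewrite !mulr_sumr.
      under eq_bigr do rewrite exchange_big.
      rewrite exchange_big; apply: eq_bigr => j _.
      by apply: eq_bigr => l _; apply: eq_bigr => l' _; ring.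
    rewrite mulr_sumr; apply: eq_bigr => i _; rewrite mulr_sumr; apply: eq_bigr => j _.
    rewrite /gram exprMn [(\sum_l _) ^+ 2]expr2 mulr_suml !mulr_sumr.
    apply: eq_bigr => l _; rewrite !mulr_sumr; apply: eq_bigr => l' _; ring.
  rewrite sum_sym_pairs; last by move=> i j; rewrite gramC; ring.
  rewrite mulrDr mulrA; congr (_ * _ + _ * _); last by ring.
  apply: eq_bigr => i _.
  have -> : rho ^+ 2 * (b i * b i) * gram (x i) (x i) ^+ 2
     = (rho * gram (x i) (x i)) ^+ 2 * b i ^+ 2 by ring.
  by rewrite gram_diag expr1n mul1r.
under eq_avg do rewrite expE expRD mulrC.
rewrite avgZ.
apply: (@le_trans _ _ (expR (- \sum_(i <- s) b i) *
  expR (h * (\sum_(l <- r) th l ^+ 2) / 2 - (\sum_(l <- r) X l l) / 2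
           + (\sum_(l <- r) \sum_(l' <- r) X l l' ^+ 2) / 2))).
  apply: ler_wpM2l; first exact: expR_ge0.
  apply: (@rademacher_quadratic R D del) => //.
  - exact: index_enum_uniq.
  - move=> l l'; rewrite /X eq_sym; case: eqP => // _; rewrite /X0; congr (_ * _).
    by apply: eq_bigr => i _; ring.
  - by move=> l; rewrite /X eqxx.
  (* By [psd] the form I + X is at least (1 - del) |y|^2, so completing the square in each
     coordinate allows T = h |th|^2. *)
  - move=> y; have := psd y.
    have : \sum_(l <- r) (2 * (th l * y l) - (1 - del) * y l ^+ 2)
           <= \sum_(l <- r) h * th l ^+ 2.
      apply: ler_sum => l _; rewrite /h.
      have d1 : 0 < 1 - del by lra.
      rewrite ler_pdivlMl //.
      by have := sqr_ge0 (th l - (1 - del) * y l); lra.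
    rewrite sumrB -!mulr_sumr; lra.
rewrite -expRD ler_expR.
have -> : \sum_(l <- r) X l l = 0 by apply: big1 => l _; rewrite /X eqxx.
rewrite thE !big_split /= sumrN.
have -> : \sum_(i <- s) h / 2 * a i ^+ 2 = h / 2 * \sum_(i <- s) a i ^+ 2.
  by rewrite mulr_sumr.
have -> : \sum_(i <- s) 2 * b i ^+ 2 = 2 * \sum_(i <- s) b i ^+ 2.
  by rewrite mulr_sumr.
have -> : \sum_(z <- pairs s) h * rho * (a z.1 * a z.2) * gram (x z.1) (x z.2)
  = h * \sum_(z <- pairs s) rho * (a z.1 * a z.2) * gram (x z.1) (x z.2).
  by rewrite mulr_sumr; apply: eq_bigr => z _; ring.
have -> : \sum_(z <- pairs s) 4 * rho ^+ 2 * (b z.1 * b z.2) * gram (x z.1) (x z.2) ^+ 2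
  = 4 * \sum_(z <- pairs s) rho ^+ 2 * (b z.1 * b z.2) * gram (x z.1) (x z.2) ^+ 2.
  by rewrite mulr_sumr; apply: eq_bigr => z _; ring.
lra.
Qed.
End Gram.

(** * Averaging out all labels for Gaussian weights on pairs *)

Section GramMoment.
Variables (R : realType) (D V : finType) (rho : R).
Hypothesis rho0 : 0 < rho.
Hypothesis rhoD : rho ^+ 2 * #|D|%:R = 1.
Local Notation label := {ffun D -> bool}.
Local Notation gram := (gram rho).

Variables (N : nat) (del b0 err : R) (al : nat -> R).
Local Notation h := (1 - del)^-1.
Hypotheses (del0 : 0 < del) (del4 : del <= 1 / 4) (b00 : 0 < b0) (err0 : 0 <= err).
Hypothesis al2 : forall n, `|al n| <= 2.
Hypothesis al_step : forall n, (n < N)%N -> `|al n.+1 + h * rho * al n.+1 ^+ 2 - al n| <= err.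

(** The vertex removed with m others remaining has m pairs, each with coefficient about [al m.+1],
    and each contributes half its square (times [h]). *)
Definition main_term (n : nat) : R :=
  \sum_(0 <= m < n) m%:R * (h / 2) * al m.+1 ^+ 2.

(** The first two terms are what [gram_step] charges for a pair. The others are reserves: for the
    later decrease of [b] (at most 4 rho^2 b0^2 per removal), for the distance to the trajectory,
    and for its linearisation errors, at most [err] per removal. *)
Definition pair_cost (n : nat) (a b : R) : R :=
  - b + 2 * b ^+ 2 + 4 * n%:R * rho ^+ 2 * b0 ^+ 2
  + 8 * `|a - al n| + 8 * n%:R * err.

(* The coefficients [a], [b] on the pairs of remaining vertices change each time a
   vertex is averaged out; [al] is the trajectory of a constant coefficient, and
   the cost of a pair grows linearly with its distance to that trajectory. *)
Lemma gram_moment (s : seq V) (a b : V -> V -> R) : uniq s -> (size s <= N)%N ->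
  8 * (size s)%:R * rho <= 1 ->
  2 * rho ^+ 2 * ((size s)%:R * b0) <= del ->
  (forall i j, `|a i j| <= 2 - 8 * (size s)%:R * rho) ->
  (forall i j, 4 * (size s)%:R * rho ^+ 2 * b0 ^+ 2 <= b i j <= b0) ->
  avg (fun x : {ffun V -> label} => expR (\sum_(z <- pairs s)
      (a z.1 z.2 * gram (x z.1) (x z.2) - b z.1 z.2 * gram (x z.1) (x z.2) ^+ 2)))
  <= expR (main_term (size s)
           + \sum_(z <- pairs s) pair_cost (size s) (a z.1 z.2) (b z.1 z.2)).
Proof.
have d4 := del4; have r0 := rho0; have e00 := err0.
have h0 : 0 < h by rewrite invr_gt0; lra.
have h2 : h <= 4 / 3 by rewrite -[h]div1r ler_pdivrMr; lra.
have lab0 : (0 < #|{: label}|)%N by rewrite card_ffun expn_gt0 card_bool.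
elim: s a b => [|u s IH] a b /=.
  move=> _ _ _ _ _ _; under eq_avg do rewrite big_nil expR0.
  rewrite avg_const; last by rewrite card_ffun expn_gt0 lab0.
  by rewrite big_nil /main_term big_geq // addr0 expR0.
move=> /andP[us ss] sN nrho nd ha hb.
set n := size s; rewrite -/n in nrho nd ha hb.
have rho2 : 0 < rho ^+ 2 by rewrite exprn_gt0.
have n0 : 0 <= n%:R :> R by rewrite ler0n.
have nS : n.+1%:R = n%:R + 1 :> R by rewrite -natr1.
have hb0 i j : 0 <= b i j.
  have /andP[+ _] := hb i j; apply: le_trans.
  do ![apply: mulr_ge0]; rewrite ?ler0n ?sqr_ge0 //; exact: ltW.
have hb1 i j : b i j <= b0 by have /andP[] := hb i j.
have ha2 i j : `|a i j| <= 2.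
  have := ha i j; rewrite nS.
  have : 0 <= n%:R * rho by rewrite mulr_ge0 // ltW.
  lra.
(* The coefficients on the remaining pairs after [gram_step] has averaged out [u]. *)
pose a' i j := a i j + h * rho * (a u i * a u j).
pose b' i j := b i j - 4 * rho ^+ 2 * (b u i * b u j).
have bb i j : 0 <= b u i * b u j <= b0 ^+ 2.
  by rewrite mulr_ge0 // expr2 ler_pM.
have b'le i j : b' i j <= b i j.
  have /andP[b1 _] := bb i j; rewrite /b' gerBl.
  by rewrite !mulr_ge0 // ltW.
have b'ge i j : b i j - 4 * rho ^+ 2 * b0 ^+ 2 <= b' i j.
  have /andP[_ b1] := bb i j; rewrite /b' lerD2l lerN2.
  by apply: ler_wpM2l => //; rewrite mulr_ge0 // ltW.
have aa i j : `|a u i * a u j| <= 4.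
  rewrite normrM; have := ha2 u i; have := ha2 u j.
  have := normr_ge0 (a u i); have := normr_ge0 (a u j); nra.
have hrho : 0 <= h * rho by rewrite mulr_ge0 // ltW.
have hrho2 : h * rho <= 4 / 3 * rho by apply: ler_wpM2r => //; rewrite ltW.
have IH' := IH a' b' ss (ltnW sN).
have {}IH' : avg (fun x : {ffun V -> label} => expR (\sum_(z <- pairs s)
      (a' z.1 z.2 * gram (x z.1) (x z.2) - b' z.1 z.2 * gram (x z.1) (x z.2) ^+ 2)))
  <= expR (main_term n + \sum_(z <- pairs s) pair_cost n (a' z.1 z.2) (b' z.1 z.2)).
  apply: IH' => [||i j|i j].
  - by move: nrho; rewrite nS; have := ltW rho0; rewrite -/n; lra.
  - apply: le_trans nd; rewrite nS -/n.
    have : rho ^+ 2 * (n%:R * b0) <= rho ^+ 2 * ((n%:R + 1) * b0).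
      by apply: ler_wpM2l; [exact: ltW|apply: ler_wpM2r; [exact: ltW|rewrite lerDl]].
    lra.
  (* One removal moves a coefficient by at most h * rho * 4 <= 16/3 * rho, within the allowance of 8
     * rho per vertex. *)
  - apply: le_trans (ler_normD _ _) _.
    have := ha i j; rewrite nS normrM (ger0_norm hrho) -/n => h1.
    have : h * rho * `|a u i * a u j| <= h * rho * 4 by apply: ler_wpM2l.
    lra.
  - have /andP[h1 h3] := hb i j; have := b'ge i j; have := b'le i j.
    move: h1; rewrite nS -/n => h1 h4 h5; apply/andP; split; last exact: le_trans h3.
    by lra.
rewrite (avg_upd _ u) //.
pose K := \sum_(i <- s) (h / 2 * a u i ^+ 2 - b u i + 2 * b u i ^+ 2).
apply: (@le_trans _ _ (avg (fun x : {ffun V -> label} => expR K *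
  expR (\sum_(z <- pairs s)
      (a' z.1 z.2 * gram (x z.1) (x z.2) - b' z.1 z.2 * gram (x z.1) (x z.2) ^+ 2))))).
  apply: ler_avg => x.
  have E y : \sum_(z <- [seq (u, i) | i <- s] ++ pairs s)
      (a z.1 z.2 * gram (upd x u y z.1) (upd x u y z.2)
       - b z.1 z.2 * gram (upd x u y z.1) (upd x u y z.2) ^+ 2)
     = \sum_(z <- pairs s)
      (a z.1 z.2 * gram (x z.1) (x z.2) - b z.1 z.2 * gram (x z.1) (x z.2) ^+ 2)
     + \sum_(i <- s) (a u i * gram (x i) y - b u i * gram (x i) y ^+ 2).
    have ne i : i \in s -> i != u.
      by move=> si; apply/negP => /eqP iu; rewrite iu (negPf us) in si.
    rewrite big_cat big_map /= addrC; congr (_ + _).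
      by apply: eq_big_seq => z /mem_pairs[z1 z2]; rewrite !upd_other ?ne.
    by apply: eq_big_seq => i si; rewrite upd_same upd_other ?ne // gramC.
  under eq_avg do rewrite E expRD.
  rewrite avgZ.
  have st := @gram_step R D rho rho0 rhoD V s x (a u) (b u) del del0 del4 (hb0 u).
  apply: le_trans (ler_wpM2l (expR_ge0 _) (st _)) _.
    apply: le_trans nd; apply: ler_wpM2l; first by rewrite mulr_ge0 // ltW.
    apply: (@le_trans _ _ (\sum_(i <- s) b0)); first by apply: ler_sum.
    rewrite big_const_seq count_predT iter_addr_0 -[b0 *+ _]mulr_natl.
    by apply: ler_wpM2r; [exact: ltW|rewrite ler_nat].
  rewrite -!expRD ler_expR -/K addrCA lerD2l -big_split /=.
  by apply: ler_sum => z _; rewrite /a' /b' le_eqVlt; apply/orP; left; apply/eqP; ring.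
rewrite avgZ; apply: le_trans (ler_wpM2l (expR_ge0 _) IH') _; clear IH IH'.
rewrite -expRD ler_expR /main_term big_nat_recr //= -/(main_term n).
rewrite sum_pairs_cons.
pose e i := `|a u i - al n.+1|.
have e0 i : 0 <= e i by exact: normr_ge0.
have alb := al2 n.+1.
have sqr_e i : a u i ^+ 2 <= al n.+1 ^+ 2 + 4 * e i.
  have -> : a u i ^+ 2 = al n.+1 ^+ 2 + (a u i - al n.+1) * (a u i + al n.+1) by ring.
  rewrite lerD2l; apply: le_trans (ler_norm _) _; rewrite normrM mulrC.
  apply: ler_wpM2r => //; apply: le_trans (ler_normD _ _) _.
  by have := ha2 u i; lra.
have prod_e i j : `|a u i * a u j - al n.+1 ^+ 2| <= 2 * (e i + e j).
  have -> : a u i * a u j - al n.+1 ^+ 2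
     = (a u i - al n.+1) * a u j + al n.+1 * (a u j - al n.+1) by ring.
  apply: le_trans (ler_normD _ _) _; rewrite !normrM -/(e i) -/(e j).
  have := ler_wpM2l (e0 i) (ha2 u j); have := ler_wpM2r (e0 j) alb; lra.
have err1 : 0 <= n%:R * err by rewrite mulr_ge0.
have rb1 : 0 <= rho ^+ 2 * b0 ^+ 2 by rewrite mulr_ge0 ?sqr_ge0.
have rb : 0 <= n%:R * (rho ^+ 2 * b0 ^+ 2) by rewrite mulr_ge0.
have hK : K <= \sum_(i <- s) pair_cost n.+1 (a u i) (b u i)
    + n%:R * (h / 2) * al n.+1 ^+ 2 - 4 * \sum_(i <- s) e i.
  have -> : n%:R * (h / 2) * al n.+1 ^+ 2 = \sum_(i <- s) h / 2 * al n.+1 ^+ 2.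
    by rewrite big_const_seq count_predT iter_addr_0 -[_ *+ size s]mulr_natl -!mulrA.
  rewrite mulr_sumr -big_split -sumrB; apply: ler_sum => i _ /=.
  rewrite /pair_cost nS -/(e i).
  have : h / 2 * a u i ^+ 2 <= h / 2 * (al n.+1 ^+ 2 + 4 * e i).
    by apply: ler_wpM2l => //; rewrite divr_ge0 // ltW.
  have : h * e i <= 4 / 3 * e i by apply: ler_wpM2r.
  have := e0 i; lra.
have hP : \sum_(z <- pairs s) pair_cost n (a' z.1 z.2) (b' z.1 z.2)
   <= \sum_(z <- pairs s) pair_cost n.+1 (a z.1 z.2) (b z.1 z.2)
     + 32 * rho * \sum_(z <- pairs s) (e z.1 + e z.2).
  rewrite mulr_sumr -big_split /=; apply: ler_sum => -[i j] _ /=.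
  rewrite /pair_cost nS.
  have q1 : `|a' i j - al n| <= `|a i j - al n.+1| + h * rho * (2 * (e i + e j)) + err.
    have -> : a' i j - al n = (a i j - al n.+1)
       + h * rho * (a u i * a u j - al n.+1 ^+ 2)
       + (al n.+1 + h * rho * al n.+1 ^+ 2 - al n) by rewrite /a'; ring.
    apply: le_trans (ler_normD _ _) _; apply: lerD (al_step sN).
    apply: le_trans (ler_normD _ _) _; rewrite lerD2l normrM (ger0_norm hrho).
    exact: ler_wpM2l.
  have q2 : h * rho * (2 * (e i + e j)) <= 4 / 3 * rho * (2 * (e i + e j)).
    by apply: ler_wpM2r => //; rewrite mulr_ge0 // addr_ge0.
  have q3 : b' i j ^+ 2 <= b i j ^+ 2.
    have := b'ge i j; have := b'le i j; have /andP[+ _] := hb i j.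
    rewrite nS => w1 w2 w3.
    have : 0 <= b' i j by lra.
    by move=> w4; rewrite ler_sqr ?nnegrE.
  have := b'ge i j.
  have q4 : 0 <= rho * (e i + e j) by rewrite mulr_ge0 ?addr_ge0 // ltW.
  rewrite -/(e i) -/(e j); lra.
(* Deviations at pairs of [u] spread with factor rho to all remaining pairs. The reserve 4 e left
   over in [hK] pays for this because 8 n rho <= 1. *)
have hE : 32 * rho * \sum_(z <- pairs s) (e z.1 + e z.2) <= 4 * \sum_(i <- s) e i.
  have := sum_pairs_add s e0; rewrite -/n => h1.
  have h3 : 0 <= \sum_(i <- s) e i by apply: sumr_ge0.
  have h4 : rho * \sum_(z <- pairs s) (e z.1 + e z.2) <= rho * (n%:R * \sum_(i <- s) e i).
    by apply: ler_wpM2l => //; exact: ltW.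
  have h5 : 8 * n%:R * rho <= 1 by move: nrho; rewrite nS; have := ltW rho0; lra.
  have h6 : 8 * n%:R * rho * \sum_(i <- s) e i <= 1 * \sum_(i <- s) e i by apply: ler_wpM2r.
  lra.
rewrite /= -/n; lra.
Qed.
End GramMoment.

(** * Products of sums of Gaussian weights *)

Section Mixture.
Variables (R : realType) (D V : finType) (rho : R).
Hypothesis rho0 : 0 < rho.
Hypothesis rhoD : rho ^+ 2 * #|D|%:R = 1.
Local Notation label := {ffun D -> bool}.
Local Notation gram := (gram rho).
Variables (N : nat) (del b0 err : R) (al : nat -> R).
Hypotheses (del0 : 0 < del) (del4 : del <= 1 / 4) (b00 : 0 < b0) (err0 : 0 <= err).
Hypothesis al2 : forall n, `|al n| <= 2.
Hypothesis al_step :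
  forall n, (n < N)%N -> `|al n.+1 + (1 - del)^-1 * rho * al n.+1 ^+ 2 - al n| <= err.

(** Expanding the product assigns a component to every pair, and [gram_moment] applies to each
    assignment. Its exponent is a sum over pairs plus a term independent of the assignment, so the
    expansion folds back into a power. *)
Lemma gram_mixture (J : finType) (j0 : J) (w ca cb : J -> R) (s : seq V) :
  uniq s -> (size s <= N)%N ->
  8 * (size s)%:R * rho <= 1 ->
  2 * rho ^+ 2 * ((size s)%:R * b0) <= del ->
  (forall j, 0 <= w j) ->
  (forall j, `|ca j| <= 2 - 8 * (size s)%:R * rho) ->
  (forall j, 4 * (size s)%:R * rho ^+ 2 * b0 ^+ 2 <= cb j <= b0) ->
  avg (fun x : {ffun V -> label} => \prod_(z <- pairs s)
     \sum_j w j * expR (ca j * gram (x z.1) (x z.2)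
                        - cb j * gram (x z.1) (x z.2) ^+ 2))
  <= expR (main_term del al (size s)) *
     (\sum_j w j * expR (pair_cost rho b0 err al (size s) (ca j) (cb j)))
       ^+ 'C(size s, 2).
Proof.
move=> us sN h1 h2 w0 hca hcb.
have ups := uniq_pairs us.
set P := pairs s.
rewrite -size_pairs -/P -(card_uniqP ups) -prodr_const.
rewrite (big_distr_big_dep j0) /= mulr_sumr.
under eq_avg do rewrite big_uniq // (big_distr_big_dep j0) /=.
rewrite avg_sum; apply: ler_sum => f _.
under eq_avg do rewrite big_split /= -expR_sum -[\sum_(i in P) _]big_uniq //.
rewrite avgZ big_split /= -expR_sum -[\sum_(i in P) _]big_uniq //.
rewrite [leRHS]mulrCA; apply: ler_wpM2l; first exact: prodr_ge0.
rewrite -expRD.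
have := @gram_moment R D V rho rho0 rhoD N del b0 err al del0 del4 b00 err0 al2 al_step
  s (fun i j => ca (f (i, j))) (fun i j => cb (f (i, j))) us sN h1 h2.
move=> /(_ (fun i j => hca _) (fun i j => hcb _)).
congr (_ <= _); last by congr (expR (_ + _)); apply: eq_bigr => -[i j].
by apply: eq_avg => x; congr expR; apply: eq_bigr => -[i j].
Qed.
End Mixture.

(** * Pointwise lower bounds for the exponential and the two edge weights *)

Section Taylor.
Import numFieldNormedType.Exports.

Lemma mvt_ex (R : realType) (f df : R -> R) (x y : R) :
  (forall z, is_derive z (1 : R) f (df z)) -> x <= y ->
  exists2 c : R, x <= c <= y & f y - f x = df c * (y - x).
Proof.
move=> fd xy.
have ct : {within `[x, y], continuous f}%classic.
  by apply: derivable_within_continuous => z _; have [] := fd z.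
have [c] := MVT_segment xy (fun z _ => fd z) ct.
by rewrite in_itv /=; exists c.
Qed.

(** It holds on both sides of 0 because the degree is odd: the second derivative of the remainder is
    exp z - (1 + z) >= 0, so the first has the sign of z and the remainder is nonnegative. *)
Lemma expR_ge_cubic (R : realType) (x : R) :
  1 + x + x ^+ 2 / 2 + x ^+ 3 / 6 <= expR x.
Proof.
pose f2 (x : R) := expR x - (1 + x + x ^+ 2 / 2).
pose f3 (x : R) := expR x - (1 + x + x ^+ 2 / 2 + x ^+ 3 / 6).
have d2 y : is_derive y (1 : R) f2 (expR y - (1 + y)).
  apply: is_derive_eq; rewrite /GRing.scale /=; by field.
have d3 y : is_derive y (1 : R) f3 (f2 y).
  apply: is_derive_eq; rewrite /f2 /GRing.scale /=; by field.
have f20 : f2 0 = 0 by rewrite /f2 expR0; ring.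
have f30 : f3 0 = 0 by rewrite /f3 expR0; ring.
have h1 (z : R) : 0 <= expR z - (1 + z) by rewrite subr_ge0 expR_ge1Dx.
suff : 0 <= f3 x by rewrite subr_ge0.
have [x0|x0] := leP 0 x.
  have [c /andP[c0 _]] := mvt_ex d3 x0; rewrite f30 !subr0 => ->.
  have [c' _] := mvt_ex d2 c0; rewrite f20 !subr0 => ->.
  by apply: mulr_ge0 => //; apply: (mulr_ge0 (h1 _)).
have [c /andP[_ c0]] := mvt_ex d3 (ltW x0); rewrite f30 !sub0r mulrN => /oppr_inj ->.
have [c' _] := mvt_ex d2 c0; rewrite f20 !sub0r mulrN => /oppr_inj ->.
apply: mulr_le0 (ltW x0); exact: mulr_ge0_le0 (h1 _) c0.
Qed.
End Taylor.

Section Pointwise.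
Variable R : realType.

(** Here [a] counts as first order and [c] as second order. The higher terms a^2 c / 2, a c^2 / 2
    and c^3 / 6 cost 1/2 + 1/2 + 1/3 = 4/3 times u^2, and c^2 / 2 is dropped as nonnegative. *)
Lemma expR_shift_ge (a c u : R) : `|a| <= 1 -> a ^+ 2 <= u -> `|c| <= u -> u <= 2 ->
  1 + a + a ^+ 2 / 2 + a ^+ 3 / 6 + c + a * c - 4 / 3 * u ^+ 2 <= expR (a + c).
Proof.
move=> a1 au cu u2; apply: le_trans (expR_ge_cubic (a + c)).
have u0 : 0 <= u by apply: le_trans cu.
have c2 : c ^+ 2 <= u ^+ 2 by rewrite -real_normK ?num_real // lerXn2r ?nnegrE.
have h1 : - u ^+ 2 <= a ^+ 2 * c.
  rewrite lerNl; apply: le_trans (ler_norm _) _.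
  by rewrite normrN normrM ger0_norm ?sqr_ge0 // expr2 ler_pM ?sqr_ge0.
have h2 : - u ^+ 2 <= a * c ^+ 2.
  rewrite lerNl; apply: le_trans (ler_norm _) _.
  rewrite normrN normrM [`|c ^+ 2|]ger0_norm ?sqr_ge0 // -[leRHS]mul1r.
  by rewrite ler_pM ?sqr_ge0.
have h3 : - (2 * u ^+ 2) <= c ^+ 3.
  rewrite lerNl; apply: le_trans (ler_norm _) _.
  rewrite normrN exprS normrM [`|c ^+ 2|]ger0_norm ?sqr_ge0 //.
  by rewrite ler_pM ?sqr_ge0 // (le_trans cu).
have := sqr_ge0 c; lra.
Qed.

Definition linear_corr (r : R) : R := (1 - r ^+ 2) / 3.
Definition quad1 (r : R) : R := (1 + 2 * r) / 6.
Definition quad2 (r : R) : R := r * (2 + r) / 6.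

(* [quad1], [quad2] and [linear_corr] are the values for which the expansion of
   [r exp(exponent1) + exp(exponent2)] agrees with [1 + r] up to third order in [eps]. *)
Definition exponent1 (r eps g : R) : R :=
  (quad1 r - 1 / 2) * eps ^+ 2 - (1 + linear_corr r * eps ^+ 2) * eps * g
  - quad1 r * eps ^+ 2 * g ^+ 2.
Definition exponent2 (r eps g : R) : R :=
  (quad2 r - r ^+ 2 / 2) * eps ^+ 2 + r * eps * g - quad2 r * eps ^+ 2 * g ^+ 2.

(** For y = |g| / 2 the left side is (g^2 + 1)^2. The constant is 400 = 16 * 4! + 8 * 2!. *)
Lemma poly_le_expR (y : R) : 0 <= y -> 16 * y ^+ 4 + 8 * y ^+ 2 + 1 <= 400 * expR y.
Proof.
move=> y0; have h4 := expR_ge1Dxn 3 y0; have h2 := expR_ge1Dxn 1 y0.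
have f4 : 4`!%:R = 24 :> R by [].
have f2 : 2`!%:R = 2 :> R by [].
rewrite f4 in h4; rewrite f2 in h2; have y2 := sqr_ge0 y.
lra.
Qed.

(** If eps |g| > 1, the last term alone suffices. Otherwise the cubic expansions of the two
    exponentials add up to at least 1 + r, and the last term pays for their remainders; 600 is 4/3 *
    400 rounded up. *)
Lemma exponent_cover (r eps g : R) : 0 <= r <= 1 -> 0 < eps <= 1 ->
  1 + r <= r * expR (exponent1 r eps g) + expR (exponent2 r eps g)
           + 600 * (1 + r) * eps ^+ 4 * expR (`|g| / 2).
Proof.
move=> /andP[r0 r1] /andP[e0 e1].
have g20 : 0 <= `|g| / 2 by rewrite divr_ge0.
have e4 : 0 < eps ^+ 4 by rewrite exprn_gt0.
have [v1|v1] := leP (`|eps * g|) 1; last first.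
  have h0 : 0 <= r * expR (exponent1 r eps g) by rewrite mulr_ge0 ?expR_ge0.
  have h1 : 0 <= expR (exponent2 r eps g) by exact: expR_ge0.
  suff : 1 <= 600 * eps ^+ 4 * expR (`|g| / 2).
    by move=> h2; have := ler_wpM2l (_ : 0 <= 1 + r) h2; lra.
  have : 1 <= (eps * `|g|) ^+ 4.
    by rewrite exprn_ege1 // ltW //; move: v1; rewrite normrM (gtr0_norm e0).
  rewrite exprMn => h2.
  have : eps ^+ 4 * (16 * (`|g| / 2) ^+ 4) <= eps ^+ 4 * (400 * expR (`|g| / 2)).
    apply: ler_wpM2l; first exact: ltW.
    by have := poly_le_expR g20; have := sqr_ge0 (`|g| / 2); lra.
  rewrite expr_div_n; lra.
set v := eps * g in v1 *.
set u := v ^+ 2 + eps ^+ 2.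
have e2 : 0 <= eps ^+ 2 <= 1 by rewrite sqr_ge0 exprn_ile1 // ltW.
have v2 : 0 <= v ^+ 2 <= 1.
  by rewrite sqr_ge0 -real_normK ?num_real // exprn_ile1.
have r2 : 0 <= r ^+ 2 <= r by rewrite sqr_ge0 expr2 ler_piMl.
pose c1 := - linear_corr r * eps ^+ 2 * v - quad1 r * v ^+ 2 + (quad1 r - 1 / 2) * eps ^+ 2.
pose c2 := - quad2 r * v ^+ 2 + (quad2 r - r ^+ 2 / 2) * eps ^+ 2.
have s03 : 0 <= linear_corr r <= 1 / 3 by rewrite /linear_corr; lra.
have c1u : `|c1| <= u.
  have [s0 s1] := andP s03; have [e20 e21] := andP e2.
  have A0 : 0 <= linear_corr r * eps ^+ 2 by exact: mulr_ge0.
  have A1 : linear_corr r * eps ^+ 2 <= 1 / 3 * eps ^+ 2 by exact: ler_wpM2r.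
  have : `|linear_corr r * eps ^+ 2 * v| <= 1 / 3 * eps ^+ 2.
    by rewrite normrM (ger0_norm A0) -[leRHS]mulr1 ler_pM.
  rewrite ler_norml => /andP[k1 k2].
  have k3 : 0 <= quad1 r * v ^+ 2 <= 1 / 2 * v ^+ 2.
    by rewrite mulr_ge0 ?ler_wpM2r //= /quad1; lra.
  have k4 : 0 <= (1 / 2 - quad1 r) * eps ^+ 2 <= 1 / 3 * eps ^+ 2.
    by rewrite mulr_ge0 ?ler_wpM2r //= /quad1; lra.
  rewrite /c1 /u ler_norml; apply/andP; split; lra.
have c2u : `|c2| <= u.
  have k3 : 0 <= quad2 r * v ^+ 2 <= 1 / 2 * v ^+ 2.
    by rewrite mulr_ge0 ?ler_wpM2r //= /quad2; nra.
  have k4 : 0 <= (quad2 r - r ^+ 2 / 2) * eps ^+ 2 <= 1 / 3 * eps ^+ 2.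
    by rewrite mulr_ge0 ?ler_wpM2r //= /quad2; nra.
  rewrite /c2 /u ler_norml; apply/andP; split; lra.
have u2 : u <= 2 by rewrite /u; lra.
have E1 : expR (exponent1 r eps g) = expR (- v + c1).
  by congr expR; rewrite /exponent1 /c1 /v; ring.
have E2 : expR (exponent2 r eps g) = expR (r * v + c2).
  by congr expR; rewrite /exponent2 /c2 /v; ring.
have T1 := @expR_shift_ge (- v) c1 u _ _ c1u u2.
have T2 := @expR_shift_ge (r * v) c2 u _ _ c2u u2.
have {}T1 := T1 _ _.
have : 1 + (- v) + (- v) ^+ 2 / 2 + (- v) ^+ 3 / 6 + c1 + (- v) * c1 - 4 / 3 * u ^+ 2
   <= expR (- v + c1).
  by apply: T1; rewrite ?normrN ?sqrrN /u //; lra.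
move=> /(ler_wpM2l r0) {}T1.
have {}T2 : 1 + r * v + (r * v) ^+ 2 / 2 + (r * v) ^+ 3 / 6 + c2 + r * v * c2
   - 4 / 3 * u ^+ 2 <= expR (r * v + c2).
  apply: T2; first by rewrite normrM (ger0_norm r0) mulr_ile1.
  by rewrite exprMn /u; have : r ^+ 2 * v ^+ 2 <= 1 * v ^+ 2 by [apply: ler_wpM2r; lra]; lra.
(* Everything through third order cancels; the surviving fourth-order term is nonnegative because r
   <= 1. *)
have main : r * (1 + (- v) + (- v) ^+ 2 / 2 + (- v) ^+ 3 / 6 + c1 + (- v) * c1)
  + (1 + r * v + (r * v) ^+ 2 / 2 + (r * v) ^+ 3 / 6 + c2 + r * v * c2)
  = 1 + r + r * linear_corr r * eps ^+ 2 * v ^+ 2.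
  by rewrite /c1 /c2 /linear_corr /quad1 /quad2; field.
have m0 : 0 <= r * linear_corr r * eps ^+ 2 * v ^+ 2.
  have [s0 _] := andP s03; rewrite mulr_ge0 ?sqr_ge0 // mulr_ge0 ?sqr_ge0 //.
  exact: mulr_ge0.
have uE : 4 / 3 * u ^+ 2 <= 600 * eps ^+ 4 * expR (`|g| / 2).
  have -> : u ^+ 2 = eps ^+ 4 * (16 * (`|g| / 2) ^+ 4 + 8 * (`|g| / 2) ^+ 2 + 1).
    have -> : (`|g| / 2) ^+ 4 = ((`|g| / 2) ^+ 2) ^+ 2 by rewrite -exprM.
    by rewrite !expr_div_n real_normK ?num_real // /u /v; field.
  have := ler_wpM2l (ltW e4) (poly_le_expR g20); have := mulr_ge0 (ltW e4) (expR_ge0 (`|g| / 2)); lra.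
have := ler_wpM2l (_ : 0 <= 1 + r) uE; rewrite E1 E2; lra.
Qed.
End Pointwise.

(** * Binomial sums and the triangle contribution *)

Lemma sum_nat_bin2 k : (\sum_(0 <= m < k) m = 'C(k, 2))%N.
Proof. by rewrite bin2_sum. Qed.

(** Triples counted by their middle element. *)
Lemma sum_nat_bin3 k : (\sum_(0 <= m < k) m * (k - m.+1) = 'C(k, 3))%N.
Proof.
elim: k => [|k IH]; first by rewrite big_geq.
rewrite big_nat_recr //= subnn muln0 addn0 binS -IH -sum_nat_bin2 -big_split /=.
by rewrite !big_mkord; apply: eq_bigr => m _; have := ltn_ord m; nia.
Qed.

Lemma bin2_le (R : realType) (k : nat) : 'C(k, 2)%:R <= k%:R ^+ 2 / 2 :> R.
Proof.
rewrite ler_pdivlMr // -natrX -natrM ler_nat.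
by rewrite (leq_trans _ (_ : 'C(k, 2) * 2`! <= _)%N) // bin_ffact ffactnS ffactn1; nia.
Qed.

Lemma bin3_le (R : realType) (k : nat) : 'C(k, 3)%:R <= k%:R ^+ 3 / 6 :> R.
Proof.
rewrite ler_pdivlMr // -natrX -natrM ler_nat.
have -> : 6%N = 3`! by [].
by rewrite bin_ffact !ffactnS ffactn0; nia.
Qed.

Section MainTerm.
Variable R : realType.

(** Squaring the linear trajectory gives three parts: the constant one counts pairs, the cross term
    counts triangles and carries a0^3, and the squared slope is at most eps^4 tau^2 since rho * tau
    <= 1/8. As del * tau <= 1/4, replacing [h] by 1 costs only O(tau). *)
Lemma main_term_bound (q tau eps rho del a0 : R) (k : nat) :
  8 <= q -> 1 <= tau -> 0 < eps <= 1 / 2 -> `|a0| <= 2 * eps -> k%:R <= tau ->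
  rho = (q * tau)^-1 -> del = 2 * eps ^+ 2 / (q ^+ 2 * tau) ->
  main_term del (fun n => a0 + (1 - del)^-1 * rho * a0 ^+ 2 * (k - n)%:R) k
  <= a0 ^+ 2 / 2 * 'C(k, 2)%:R + rho * a0 ^+ 3 * 'C(k, 3)%:R
     + eps ^+ 4 * tau ^+ 2 + 2 * tau.
Proof.
move=> q8 tau1 /andP[e0 e1] a0e kt rhoE delE.
set h := (1 - del)^-1.
have q0 : 0 < q by lra.
have t0 : 0 < tau by lra.
have e2 : eps ^+ 2 <= 1 / 4 by nra.
have q2 : 64 <= q ^+ 2 by nra.
have del0 : 0 <= del.
  by rewrite delE divr_ge0 ?mulr_ge0 ?sqr_ge0 // ltW.
have deltau : del * tau = 2 * eps ^+ 2 / q ^+ 2.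
  by rewrite delE; field; rewrite !gt_eqF.
have deltau2 : del * tau <= 1 / 4.
  by rewrite deltau ler_pdivrMr ?exprn_gt0 //; lra.
have del1 : del <= 1 / 4 by apply: le_trans deltau2; rewrite ler_peMr.
have h1 : 1 <= h by rewrite -[h]div1r ler_pdivlMr; lra.
have h43 : h <= 4 / 3 by rewrite -[h]div1r ler_pdivrMr; lra.
have hd : h - 1 <= 2 * del.
  have -> : h - 1 = del * h by rewrite /h; field; rewrite gt_eqF //; lra.
  by rewrite mulrC; apply: ler_wpM2r => //; lra.
have rho0 : 0 < rho by rewrite rhoE invr_gt0 mulr_gt0.
have rt : rho * tau = q^-1 by rewrite rhoE; field; rewrite !gt_eqF.
have qi : q^-1 <= 1 / 8 by rewrite -[q^-1]div1r ler_pdivrMr //; lra.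
have qi0 : 0 < q^-1 by rewrite invr_gt0.
have k0 : 0 <= k%:R :> R by [].
have B2 : 'C(k, 2)%:R <= tau ^+ 2 / 2.
  apply: le_trans (bin2_le _ k) _; rewrite ler_pM2r // lerXn2r ?nnegrE //; lra.
have B3 : 'C(k, 3)%:R <= tau ^+ 3 / 6.
  apply: le_trans (bin3_le _ k) _; rewrite ler_pM2r // lerXn2r ?nnegrE //; lra.
have a1 : `|a0| <= 1 by lra.
pose S3 : R := \sum_(0 <= m < k) m%:R * (k - m.+1)%:R ^+ 2.
have S30 : 0 <= S3 by apply: sumr_ge0 => m _; rewrite mulr_ge0 ?sqr_ge0.
have S3t : S3 <= tau ^+ 4.
  apply: (@le_trans _ _ (\sum_(0 <= m < k) tau ^+ 3)).
    rewrite /S3 !big_mkord; apply: ler_sum => m _.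
    have mt : m%:R <= tau by apply: le_trans kt; rewrite ler_nat ltnW.
    have kt' : (k - m.+1)%:R <= tau by apply: le_trans kt; rewrite ler_nat leq_subr.
    by rewrite [tau ^+ 3]exprS ler_pM ?sqr_ge0 // lerXn2r ?nnegrE // ltW.
  rewrite big_mkord sumr_const card_ord -[_ *+ _]mulr_natl [leRHS]exprS.
  by rewrite ler_wpM2r // exprn_ge0 // ltW.
have -> : main_term del (fun n => a0 + h * rho * a0 ^+ 2 * (k - n)%:R) k
  = h / 2 * a0 ^+ 2 * 'C(k, 2)%:R + h ^+ 2 * rho * a0 ^+ 3 * 'C(k, 3)%:R
    + h ^+ 3 / 2 * rho ^+ 2 * a0 ^+ 4 * S3.
  rewrite -sum_nat_bin2 -sum_nat_bin3 !natr_sum /S3 !mulr_sumr -!big_split /=.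
  apply: eq_bigr => m _; by rewrite natrM -/h; field.
have b20 : 0 <= 'C(k, 2)%:R :> R by [].
have b30 : 0 <= 'C(k, 3)%:R :> R by [].
have a02 : 0 <= a0 ^+ 2 <= 1.
  by rewrite sqr_ge0 -real_normK ?num_real // exprn_ile1.
have T1 : (h - 1) / 2 * a0 ^+ 2 * 'C(k, 2)%:R <= tau.
  have : (h - 1) * 'C(k, 2)%:R <= 2 * del * (tau ^+ 2 / 2) by apply: ler_pM => //; lra.
  have -> : 2 * del * (tau ^+ 2 / 2) = del * tau * tau by field.
  have : del * tau * tau <= 1 / 4 * tau by apply: ler_wpM2r => //; lra.
  move=> w1 w2.
  have w3 : (h - 1) * 'C(k, 2)%:R * a0 ^+ 2 <= (1 / 4 * tau) * 1.
    have [w4 w5] := andP a02.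
    apply: ler_pM => //; last by lra.
    by apply: mulr_ge0 => //; lra.
  lra.
have T2 : (h ^+ 2 - 1) * rho * a0 ^+ 3 * 'C(k, 3)%:R <= tau / 2.
  have w0 : a0 ^+ 3 <= 1.
    by apply: le_trans (ler_norm _) _; rewrite normrX exprn_ile1.
  have h21 : 0 <= h ^+ 2 - 1 by nra.
  have w1 : h ^+ 2 - 1 <= 14 / 3 * del.
    have -> : h ^+ 2 - 1 = (h - 1) * (h + 1) by ring.
    have -> : 14 / 3 * del = 2 * del * (7 / 3) by field.
    by apply: ler_pM; lra.
  have w2 : rho * 'C(k, 3)%:R <= 1 / 8 * tau ^+ 2 / 6.
    have : rho * 'C(k, 3)%:R <= rho * (tau ^+ 3 / 6) by apply: ler_wpM2l => //; rewrite ltW.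
    have -> : rho * (tau ^+ 3 / 6) = (rho * tau) * (tau ^+ 2 / 6) by field.
    rewrite rt => /le_trans; apply.
    by rewrite -mulrA; apply: ler_wpM2r => //; rewrite divr_ge0 ?sqr_ge0.
  have w3 : (h ^+ 2 - 1) * (rho * 'C(k, 3)%:R) <= (14 / 3 * del) * (1 / 8 * tau ^+ 2 / 6).
    by apply: ler_pM => //; rewrite mulr_ge0 // ltW.
  have w4 : (14 / 3 * del) * (1 / 8 * tau ^+ 2 / 6) <= tau / 2.
    have -> : (14 / 3 * del) * (1 / 8 * tau ^+ 2 / 6) = 7 / 72 * (del * tau * tau) by field.
    have : del * tau * tau <= 1 / 4 * tau by apply: ler_wpM2r => //; lra.
    lra.
  have w5 : 0 <= (h ^+ 2 - 1) * (rho * 'C(k, 3)%:R).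
    by rewrite mulr_ge0 // mulr_ge0 // ltW.
  have -> : (h ^+ 2 - 1) * rho * a0 ^+ 3 * 'C(k, 3)%:R
    = (h ^+ 2 - 1) * (rho * 'C(k, 3)%:R) * a0 ^+ 3 by ring.
  have := ler_wpM2l w5 w0; lra.
have T3 : h ^+ 3 / 2 * rho ^+ 2 * a0 ^+ 4 * S3 <= eps ^+ 4 * tau ^+ 2.
  have w1 : h ^+ 3 / 2 <= 2.
    have : h ^+ 3 <= (4 / 3) ^+ 3 by rewrite lerXn2r ?nnegrE //; lra.
    lra.
  have w2 : a0 ^+ 4 <= 16 * eps ^+ 4.
    have -> : 16 * eps ^+ 4 = (2 * eps) ^+ 4 by ring.
    have -> : a0 ^+ 4 = `|a0| ^+ 4 by rewrite -normrX ger0_norm // -[4%N]/(2 * 2)%N exprM sqr_ge0.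
    by rewrite lerXn2r ?nnegrE //; lra.
  have w3 : rho ^+ 2 * S3 <= tau ^+ 2 / 64.
    apply: (@le_trans _ _ (rho ^+ 2 * tau ^+ 4)).
      by apply: ler_wpM2l => //; exact: sqr_ge0.
    have -> : rho ^+ 2 * tau ^+ 4 = tau ^+ 2 * (rho * tau) ^+ 2 by ring.
    rewrite rt; apply: ler_wpM2l; first exact: sqr_ge0.
    have -> : 64^-1 = (1 / 8) ^+ 2 :> R by field.
    by rewrite lerXn2r ?nnegrE // ltW.
  have -> : h ^+ 3 / 2 * rho ^+ 2 * a0 ^+ 4 * S3 = (h ^+ 3 / 2 * a0 ^+ 4) * (rho ^+ 2 * S3) by ring.
  have a40 : 0 <= a0 ^+ 4 by rewrite -[4%N]/(2 * 2)%N exprM sqr_ge0.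
  have h30 : 0 <= h ^+ 3 / 2 by rewrite divr_ge0 // exprn_ge0 //; lra.
  have w4 : (h ^+ 3 / 2 * a0 ^+ 4) <= 2 * (16 * eps ^+ 4) by apply: ler_pM.
  have : (h ^+ 3 / 2 * a0 ^+ 4) * (rho ^+ 2 * S3) <= 2 * (16 * eps ^+ 4) * (tau ^+ 2 / 64).
    by apply: ler_pM => //; rewrite mulr_ge0 // sqr_ge0.
  have : 0 <= eps ^+ 4 * tau ^+ 2 by rewrite mulr_ge0 ?sqr_ge0 // exprn_ge0 // ltW.
  lra.
lra.
Qed.
End MainTerm.

(** * Moment bound for the edge kernel *)

Section MixtureBound.
Variables (R : realType) (Q t : nat) (eps : R).
Local Notation q := (Q%:R : R).
Local Notation tau := (t%:R : R).
Hypotheses (Q8 : (8 <= Q)%N) (t1 : (0 < t)%N) (heps : 0 < eps <= 1 / 2).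

Definition scale : R := (q * tau)^-1.
(* The quadratic coefficient of a pair decreases while vertices are averaged out;
   [floor_coef] is the total decrease, so that all coefficients stay nonnegative. *)
Definition floor_coef : R := 4 * eps ^+ 4 / (q ^+ 2 * tau).

(** The tail exp(|g| / 2) of [exponent_cover] is replaced by two Gaussian weights, so that all
    summands fit [gram_mixture]. Passing from |g| / 2 to |g| makes room for the damping by
    [floor_coef]. *)
Definition kernel (c0 a0 b1 g : R) : R :=
  expR (c0 + a0 * g - b1 * g ^+ 2)
  + 600 * eps ^+ 4 * (expR (g - floor_coef * g ^+ 2)
                      + expR (- g - floor_coef * g ^+ 2)).

(** Half of the 1200 e^22 per pair in [type_sum_le], as there are at most tau^2 / 2 pairs, with room
    for the remaining eps^4 terms. *)
Definition slack_const : R := 3 + 600 * expR 22.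

Let q8 : 8 <= q. Proof. by rewrite (ler_nat _ 8). Qed.
Let tau1 : 1 <= tau. Proof. by rewrite (ler_nat _ 1). Qed.

Lemma scale_gt0 : 0 < scale.
Proof. by rewrite invr_gt0 mulr_gt0 //; have := q8; have := tau1; lra. Qed.

Lemma scale_dim : scale ^+ 2 * #|'I_((Q * t) ^ 2)|%:R = 1.
Proof.
rewrite card_ord natrX natrM -exprMn mulVf ?expr1n // gt_eqF // -invr_gt0.
exact: scale_gt0.
Qed.

(** Equals 2 * scale^2 * tau * eps^2, the bound that [gram_step] asks for when at most [t] quadratic
    coefficients are at most eps^2. *)
Definition del_coef : R := 2 * eps ^+ 2 / (q ^+ 2 * tau).
Definition err_coef : R := 48 * scale ^+ 2 * tau * eps ^+ 3.
(* The coefficients of a pair that starts from [a0] in a set of [k] vertices, when [n]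
   vertices remain: linearization of a' = a + rho a^2. *)
Definition trajectory (a0 : R) (k n : nat) : R :=
  a0 + (1 - del_coef)^-1 * scale * a0 ^+ 2 * (k - n)%:R.

Let e0 : 0 < eps. Proof. by have /andP[] := heps. Qed.
Let e1 : eps <= 1 / 2. Proof. by have /andP[] := heps. Qed.
Let q0 : 0 < q. Proof. by apply: lt_le_trans q8. Qed.
Let t0 : 0 < tau. Proof. by apply: lt_le_trans tau1. Qed.
Let q2 : 64 <= q ^+ 2. Proof. by have := q8; nra. Qed.
Let e2 : 0 < eps ^+ 2 <= 1 / 4.
Proof. by have := e0; have := e1; move=> ? ?; rewrite exprn_gt0 //=; nra. Qed.
Let e3 : 0 < eps ^+ 3 <= 1 / 8.
Proof.
have h0 := e0; have h1 := e1; have /andP[h2 h3] := e2.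
rewrite exprn_gt0 //= exprS; have -> : 1 / 8 = 1 / 2 * (1 / 4) :> R by field.
by apply: ler_pM => //; rewrite ltW.
Qed.
Let e4 : 0 < eps ^+ 4 <= eps ^+ 2 / 4.
Proof.
have h0 := e0; have /andP[h2 h3] := e2.
rewrite exprn_gt0 //= (_ : eps ^+ 4 = eps ^+ 2 * eps ^+ 2); last by ring.
by apply: ler_wpM2l; lra.
Qed.

Lemma del_coef_gt0 : 0 < del_coef.
Proof. by rewrite divr_gt0 ?mulr_gt0 ?exprn_gt0. Qed.

Lemma del_coef_le : del_coef <= 1 / 4.
Proof.
have h0 := del_coef_gt0; have h1 := tau1; have /andP[h2 h3] := e2; have h4 := q2.
apply: (@le_trans _ _ (del_coef * tau)); first by rewrite ler_peMr // ltW.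
have -> : del_coef * tau = 2 * eps ^+ 2 / q ^+ 2.
  by rewrite /del_coef; field; rewrite !gt_eqF.
by rewrite ler_pdivrMr ?exprn_gt0 //; lra.
Qed.

Let scale_tau : scale * tau = q^-1.
Proof. by rewrite /scale; field; rewrite !gt_eqF. Qed.

Lemma scale_size_le (k : nat) : (k <= t)%N -> scale * k%:R <= 1 / 8.
Proof.
move=> kt; have h0 := scale_gt0; have h1 := q8.
apply: (@le_trans _ _ (scale * tau)).
  by apply: ler_wpM2l; [exact: ltW|rewrite ler_nat].
by rewrite scale_tau -[q^-1]div1r ler_pdivrMr //; lra.
Qed.

Lemma err_coef_ge0 : 0 <= err_coef.
Proof.
have /andP[h2 _] := e3.
apply: mulr_ge0; last exact: ltW.
by rewrite mulr_ge0 ?(ltW t0) // mulr_ge0 ?sqr_ge0.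
Qed.

Let h_bounds : 1 <= (1 - del_coef)^-1 <= 4 / 3.
Proof.
have h0 := del_coef_gt0; have h1 := del_coef_le.
by rewrite -div1r ler_pdivlMr ?ler_pdivrMr; lra.
Qed.

Lemma trajectory_step_bounds (a0 : R) (k n : nat) : (k <= t)%N -> `|a0| <= 2 * eps ->
  0 <= (1 - del_coef)^-1 * scale * a0 ^+ 2 * (k - n)%:R <= 1 / 6 * a0 ^+ 2.
Proof.
move=> kt a0e; have /andP[h1 h2] := h_bounds; have s0 := scale_gt0.
have rk := scale_size_le kt.
have y0 : 0 <= (1 - del_coef)^-1 * scale * a0 ^+ 2.
  by rewrite mulr_ge0 ?sqr_ge0 // mulr_ge0 ?ltW //; lra.
rewrite mulr_ge0 //=.
have : (k - n)%:R <= k%:R :> R by rewrite ler_nat leq_subr.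
move=> /(ler_wpM2l y0)/le_trans; apply.
have -> : (1 - del_coef)^-1 * scale * a0 ^+ 2 * k%:R
  = (1 - del_coef)^-1 * (scale * k%:R) * a0 ^+ 2 by ring.
apply: ler_wpM2r; first exact: sqr_ge0.
have -> : 1 / 6 = 4 / 3 * (1 / 8) :> R by field.
by apply: ler_pM => //; [lra|rewrite mulr_ge0 // ltW].
Qed.

Let a0_sqr (a0 : R) : `|a0| <= 2 * eps -> a0 ^+ 2 <= `|a0|.
Proof.
move=> a0e; have h1 := e1.
by rewrite -real_normK ?num_real // expr2 ler_piMl //; lra.
Qed.

Lemma trajectory_le2 (a0 : R) (k n : nat) : (k <= t)%N -> `|a0| <= 2 * eps ->
  `|trajectory a0 k n| <= 2.
Proof.
move=> kt a0e; have h1 := e1; have h2 := a0_sqr a0e.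
have /andP[w1 w2] := trajectory_step_bounds n kt a0e.
apply: le_trans (ler_normD _ _) _.
by rewrite (ger0_norm w1); lra.
Qed.

Lemma trajectory_step (a0 : R) (k n : nat) : (k <= t)%N -> `|a0| <= 2 * eps ->
  (n < k)%N ->
  `|trajectory a0 k n.+1
    + (1 - del_coef)^-1 * scale * trajectory a0 k n.+1 ^+ 2 - trajectory a0 k n|
  <= err_coef.
Proof.
move=> kt a0e nk; have h1 := e1; have h2 := a0_sqr a0e.
have /andP[h3 h4] := h_bounds; have s0 := scale_gt0.
have := trajectory_step_bounds n.+1 kt a0e.
rewrite /trajectory; set h := (1 - del_coef)^-1 in h3 h4 *.
set x := h * scale * a0 ^+ 2 * (k - n.+1)%:R => /andP[w1 w2].
have -> : h * scale * a0 ^+ 2 * (k - n)%:R = x + h * scale * a0 ^+ 2.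
  by rewrite /x -(subnSK nk) -natr1; ring.
(* Linearising loses only the difference of (a0 + x)^2 and a0^2. With |2 a0 + x| <= 3 |a0|, h^2 <= 2
   and |a0| <= 2 eps this gives the 48 = 3 * 2 * 8 of [err_coef]. *)
have -> : a0 + x + h * scale * (a0 + x) ^+ 2 - (a0 + (x + h * scale * a0 ^+ 2))
   = (h * scale) * (x * (2 * a0 + x)) by ring.
have h0 : 0 <= h by apply: le_trans h3.
have hs0 : 0 <= h * scale by rewrite mulr_ge0 // ltW.
rewrite normrM (ger0_norm hs0) normrM (ger0_norm w1).
have w3 : x <= h * scale * a0 ^+ 2 * tau.
  apply: ler_wpM2l; first by rewrite mulr_ge0 ?sqr_ge0.
  by rewrite ler_nat (leq_trans _ kt) // leq_subr.
have w4 : `|2 * a0 + x| <= 3 * `|a0|.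
  apply: le_trans (ler_normD _ _) _; rewrite normrM (ger0_norm w1) ger0_norm //.
  by have := normr_ge0 a0; lra.
apply: (@le_trans _ _ ((h * scale) * ((h * scale * a0 ^+ 2 * tau) * (3 * `|a0|)))).
  by apply: ler_wpM2l => //; apply: ler_pM.
have -> : (h * scale) * ((h * scale * a0 ^+ 2 * tau) * (3 * `|a0|))
   = (scale ^+ 2 * tau) * (3 * h ^+ 2 * `|a0| ^+ 3).
  by rewrite -[a0 ^+ 2]real_normK ?num_real //; ring.
have -> : err_coef = (scale ^+ 2 * tau) * (48 * eps ^+ 3) by rewrite /err_coef; ring.
apply: ler_wpM2l; first by rewrite mulr_ge0 ?sqr_ge0.
have w5 : `|a0| ^+ 3 <= 8 * eps ^+ 3.
  have -> : 8 * eps ^+ 3 = (2 * eps) ^+ 3 by ring.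
  rewrite lerXn2r ?nnegrE //; exact: le_trans a0e.
have w6 : h ^+ 2 <= 2 by nra.
have -> : 48 * eps ^+ 3 = 3 * 2 * (8 * eps ^+ 3) by ring.
by apply: ler_pM => //; [rewrite mulr_ge0 ?sqr_ge0|exact: ler_wpM2l].
Qed.

Let floor_coefE : 4 * tau * scale ^+ 2 * (eps ^+ 2) ^+ 2 = floor_coef.
Proof. by rewrite /floor_coef /scale; field; rewrite !gt_eqF. Qed.

Lemma floor_coef_ge0 : 0 <= floor_coef.
Proof.
have /andP[h4 _] := e4.
by rewrite divr_ge0 ?mulr_ge0 ?sqr_ge0 ?(ltW h4) // ltW.
Qed.

Lemma floor_coef_le : floor_coef <= eps ^+ 4 / 16.
Proof.
have /andP[h4 _] := e4; have h2 := q2; have h1 := tau1.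
rewrite ler_pdivrMr ?mulr_gt0 ?exprn_gt0 //.
have w1 : 64 * 1 <= q ^+ 2 * tau by apply: ler_pM.
have : eps ^+ 4 / 16 * (64 * 1) <= eps ^+ 4 / 16 * (q ^+ 2 * tau).
  by apply: ler_wpM2l => //; rewrite divr_ge0 // ltW.
lra.
Qed.

Let floor_coef_size (k : nat) : (k <= t)%N ->
  4 * k%:R * scale ^+ 2 * (eps ^+ 2) ^+ 2 <= floor_coef.
Proof.
move=> kt; rewrite -floor_coefE; do 2 (apply: ler_wpM2r; first exact: sqr_ge0).
by apply: ler_wpM2l; rewrite ?ler_nat.
Qed.

Definition type_coef (a0 : R) (j : 'I_3) : R :=
  if j == 0 :> nat then a0 else if j == 1 :> nat then 1 else -1.
Definition type_quad (b1 : R) (j : 'I_3) : R :=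
  if j == 0 :> nat then b1 else floor_coef.
Definition type_weight (c0 : R) (j : 'I_3) : R :=
  if j == 0 :> nat then expR c0 else 600 * eps ^+ 4.

Lemma kernelE c0 a0 b1 g : kernel c0 a0 b1 g
  = \sum_j type_weight c0 j * expR (type_coef a0 j * g - type_quad b1 j * g ^+ 2).
Proof.
rewrite /kernel 2!big_ord_recl big_ord_recl big_ord0.
rewrite /type_weight /type_coef /type_quad /= addr0.
by rewrite mul1r mulN1r -mulrDr -[c0 + _ - _]addrA (expRD c0).
Qed.

Let weight_ge0 c0 j : 0 <= type_weight c0 j.
Proof.
have /andP[h4 _] := e4; rewrite /type_weight; case: ifP => _; first exact: expR_ge0.
by lra.
Qed.

Let err_size (k : nat) : (k <= t)%N -> 8 * k%:R * err_coef <= 384 * eps ^+ 3 / q ^+ 2.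
Proof.
move=> kt; apply: (@le_trans _ _ (8 * tau * err_coef)).
  by apply: ler_wpM2r; [exact: err_coef_ge0|apply: ler_wpM2l; rewrite ?ler_nat].
have -> : 8 * tau * err_coef = 384 * eps ^+ 3 * (scale * tau) ^+ 2.
  by rewrite /err_coef; ring.
by rewrite scale_tau exprVn.
Qed.

(** The main component starts on its trajectory and pays nothing for distance. The tails lie far
    from it and cost up to e^20, but carry weight O(eps^4); the two extra units in e^22 allow for
    factoring out the main exponential, whose exponent is at least -2. *)
Lemma type_sum_le (c0 a0 b1 : R) (k : nat) : (k <= t)%N -> `|a0| <= 2 * eps ->
  eps ^+ 2 / 16 <= b1 <= eps ^+ 2 -> `|c0| <= eps ^+ 2 ->
  \sum_j type_weight c0 j * expR (pair_cost scale (eps ^+ 2) err_coef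
     (trajectory a0 k) k (type_coef a0 j) (type_quad b1 j))
  <= expR (c0 - b1 + 384 * eps ^+ 3 / q ^+ 2
           + (3 + 1200 * expR 22) * eps ^+ 4).
Proof.
move=> kt a0e /andP[b1l b1u] c0e.
have /andP[h20 h2] := e2; have /andP[h30 h3] := e3; have /andP[h40 h4] := e4.
have kerr := err_size kt; have fc := floor_coef_size kt.
have f0 := floor_coef_ge0; have f1 := floor_coef_le.
have kerr1 : 384 * eps ^+ 3 / q ^+ 2 <= 1.
  by have := q2; rewrite ler_pdivrMr ?exprn_gt0 //; lra.
have kerr0 : 0 <= 384 * eps ^+ 3 / q ^+ 2.
  by apply: divr_ge0 (sqr_ge0 _); lra.
set K := 384 * eps ^+ 3 / q ^+ 2 in kerr kerr0 kerr1 *.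
have alk : trajectory a0 k k = a0 by rewrite /trajectory subnn mulr0 addr0.
have b12 : b1 ^+ 2 <= eps ^+ 4.
  rewrite (_ : eps ^+ 4 = (eps ^+ 2) ^+ 2); last by ring.
  by rewrite lerXn2r ?nnegrE; lra.
have cost0 : pair_cost scale (eps ^+ 2) err_coef (trajectory a0 k) k a0 b1
   <= - b1 + K + 3 * eps ^+ 4.
  rewrite /pair_cost alk subrr normr0 mulr0; lra.
have cost1 a : `|a| = 1 ->
   pair_cost scale (eps ^+ 2) err_coef (trajectory a0 k) k a floor_coef <= 20.
  move=> a1'; rewrite /pair_cost alk.
  have w1 : `|a - a0| <= 2.
    by apply: le_trans (ler_normB _ _) _; have := e1; lra.
  have w2 : floor_coef ^+ 2 <= 1 by rewrite exprn_ile1; lra.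
  lra.
set X := c0 - b1 + K + 3 * eps ^+ 4.
have X2 : - 2 <= X by move: c0e; rewrite ler_norml => /andP[w1 w2]; rewrite /X; lra.
rewrite 2!big_ord_recl big_ord_recl big_ord0 /type_weight /type_coef /type_quad /= addr0.
apply: (@le_trans _ _ (expR X + 1200 * eps ^+ 4 * expR 20)).
  apply: lerD; first by rewrite -expRD ler_expR /X; lra.
  have u2 : expR (pair_cost scale (eps ^+ 2) err_coef (trajectory a0 k) k 1 floor_coef)
      <= expR 20 by rewrite ler_expR cost1 // normr1.
  have u3 : expR (pair_cost scale (eps ^+ 2) err_coef (trajectory a0 k) k (-1) floor_coef)
      <= expR 20 by rewrite ler_expR cost1 // normrN normr1.
  rewrite -mulrDr (_ : 1200 * eps ^+ 4 * expR 20 = 600 * eps ^+ 4 * (expR 20 + expR 20)); last by ring.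
  by apply: ler_wpM2l; [lra|apply: lerD].
have -> : c0 - b1 + K + (3 + 1200 * expR 22) * eps ^+ 4
   = X + 1200 * expR 22 * eps ^+ 4 by rewrite /X; ring.
rewrite expRD.
have w1 : 1 + 1200 * expR 22 * eps ^+ 4 <= expR (1200 * expR 22 * eps ^+ 4) := expR_ge1Dx _.
apply: le_trans (ler_wpM2l (expR_ge0 X) w1).
rewrite mulrDr mulr1 lerD2l.
have -> : 1200 * eps ^+ 4 * expR 20 = 1200 * eps ^+ 4 * (expR (- 2) * expR 22).
  by rewrite -expRD; congr (_ * expR _); ring.
have -> : expR X * (1200 * expR 22 * eps ^+ 4) = 1200 * eps ^+ 4 * (expR X * expR 22).
  by ring.
apply: ler_wpM2l; first by lra.
by apply: ler_wpM2r; rewrite ?expR_ge0 // ler_expR.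
Qed.

(** c0 - b1 + a0^2 / 2 is the leading part of the logarithm of the mean of one weight under a
    standard normal g; the coefficients used later make it O(eps^4). The cubic term is the triangle
    contribution, whose sign is that of [a0]. *)
Lemma kernel_bound (V : finType) (s : seq V) (c0 a0 b1 : R) :
  uniq s -> (size s <= t)%N -> `|a0| <= 2 * eps ->
  eps ^+ 2 / 16 <= b1 <= eps ^+ 2 -> `|c0| <= eps ^+ 2 ->
  avg (fun x : {ffun V -> {ffun 'I_((Q * t) ^ 2) -> bool}} =>
    \prod_(z <- pairs s) kernel c0 a0 b1 (gram scale (x z.1) (x z.2)))
  <= expR ('C(size s, 2)%:R * (c0 - b1 + a0 ^+ 2 / 2)
           + scale * a0 ^+ 3 * 'C(size s, 3)%:R
           + tau ^+ 2 * (slack_const * eps ^+ 4 + 192 * eps ^+ 3 / q ^+ 2)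
           + 2 * tau).
Proof.
move=> us st a0e b1e c0e.
set k := size s in st *.
under eq_avg do under eq_bigr do rewrite kernelE.
have kt : k%:R <= tau by rewrite ler_nat.
have d4 : del_coef <= 1 / 4 by have := del_coef_le; lra.
have /andP[h20 h2] := e2; have /andP[h40 h4] := e4; have /andP[h30 _] := e3.
have k8 : 8 * k%:R * scale <= 1 by have := scale_size_le st; lra.
have kd : 2 * scale ^+ 2 * (k%:R * eps ^+ 2) <= del_coef.
  have -> : 2 * scale ^+ 2 * (k%:R * eps ^+ 2) = (2 * eps ^+ 2 * scale ^+ 2) * k%:R by ring.
  have -> : del_coef = (2 * eps ^+ 2 * scale ^+ 2) * tau.
    by rewrite /del_coef /scale; field; rewrite !gt_eqF.
  by apply: ler_wpM2l => //; rewrite mulr_ge0 ?sqr_ge0 // mulr_ge0 ?sqr_ge0.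
have hca j : `|type_coef a0 j| <= 2 - 8 * k%:R * scale.
  rewrite /type_coef; have h1 := e1; case: ifP => _; first by lra.
  by case: ifP => _; rewrite ?normrN normr1; lra.
have hcb j : 4 * k%:R * scale ^+ 2 * (eps ^+ 2) ^+ 2 <= type_quad b1 j <= eps ^+ 2.
  have /andP[b1l b1u] := b1e.
  have fc := floor_coef_size st; have f1 := floor_coef_le.
  have w1 : floor_coef <= b1 by lra.
  have w2 : floor_coef <= eps ^+ 2 by lra.
  by rewrite /type_quad; case: ifP => _; rewrite ?b1u ?fc ?w2 //= (le_trans fc).
have := @gram_mixture R 'I_((Q * t) ^ 2) V scale scale_gt0 scale_dim k del_coef
  (eps ^+ 2) err_coef (trajectory a0 k) del_coef_gt0 d4 h20 err_coef_ge0
  (fun n => trajectory_le2 n st a0e) (fun n => @trajectory_step a0 k n st a0e)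
  'I_3 ord0 (type_weight c0) (type_coef a0) (type_quad b1) s us (leqnn _) k8 kd
  (weight_ge0 c0) hca hcb.
move=> /le_trans; apply; rewrite -/k.
have M := @main_term_bound R q tau eps scale del_coef a0 k q8 tau1 heps a0e kt erefl erefl.
have S := type_sum_le st a0e b1e c0e.
have S0 : 0 <= \sum_j type_weight c0 j * expR (pair_cost scale (eps ^+ 2) err_coef
     (trajectory a0 k) k (type_coef a0 j) (type_quad b1 j)).
  by apply: sumr_ge0 => j _; rewrite mulr_ge0 ?expR_ge0.
have -> : 'C(k, 2)%:R * (c0 - b1 + a0 ^+ 2 / 2) + scale * a0 ^+ 3 * 'C(k, 3)%:R
   + tau ^+ 2 * (slack_const * eps ^+ 4 + 192 * eps ^+ 3 / q ^+ 2) + 2 * tau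
  = (a0 ^+ 2 / 2 * 'C(k, 2)%:R + scale * a0 ^+ 3 * 'C(k, 3)%:R
     + eps ^+ 4 * tau ^+ 2 + 2 * tau)
    + ('C(k, 2)%:R * (c0 - b1) + tau ^+ 2 / 2 *
       ((2 * slack_const - 2) * eps ^+ 4 + 384 * eps ^+ 3 / q ^+ 2)).
  by field; rewrite gt_eqF.
rewrite [leRHS]expRD; apply: ler_pM; [exact: expR_ge0|exact: exprn_ge0| |].
  by rewrite ler_expR; exact: M.
apply: le_trans (_ : expR (c0 - b1 + 384 * eps ^+ 3 / q ^+ 2
   + (3 + 1200 * expR 22) * eps ^+ 4) ^+ 'C(k, 2) <= _).
  by rewrite lerXn2r ?nnegrE ?expR_ge0.
rewrite -expRM_natl ler_expR; clear M S S0.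
have B2 : 'C(k, 2)%:R <= tau ^+ 2 / 2 :> R.
  by apply: le_trans (bin2_le _ k) _; rewrite ler_pM2r // lerXn2r ?nnegrE // ltW.
rewrite /slack_const; have E22 := expR_ge0 (22 : R).
have w1 : 0 <= (3 + 1200 * expR 22) * eps ^+ 4 + 384 * eps ^+ 3 / q ^+ 2.
  by apply: addr_ge0; [apply: mulr_ge0; lra|apply: divr_ge0 (sqr_ge0 _); lra].
have := ler_wpM2r w1 B2.
have : 0 <= tau ^+ 2 / 2 * eps ^+ 4 by rewrite mulr_ge0 ?divr_ge0 ?sqr_ge0 // ltW.
set K := 384 * eps ^+ 3 / q ^+ 2; lra.
Qed.
End MixtureBound.

(** * Random graphs with independent edges and the first moment method *)

Lemma indep_probE (R : realType) n (e : rel 'I_n) s :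
  indep_prob e s
  = (\sum_(v : {ffun 'I_s -> 'I_n}) [forall i, forall j, ~~ e (v i) (v j)]%:R)
    / (n ^ s)%:R :> R.
Proof.
rewrite /indep_prob; congr (_ / _).
rewrite -natr_sum; congr (_%:R); rewrite -sum1_card big_mkcond /=.
apply: eq_bigr => v _; set b := [forall i, _].
suff -> : (v \in [set v : {ffun 'I_s -> 'I_n} |
    [forall i, forall j, ~~ e (v i) (v j)]]%classic) = b by case: b.
by apply/idP/idP => [/set_mem //|h]; exact: mem_set.
Qed.

(** Reading [E] only at increasing pairs makes the graph simple for every [E], so the entries of [E]
    can be independent. *)
Definition edge n (E : {ffun 'I_n * 'I_n -> bool}) : rel 'I_n :=
  fun u v => (u < v)%N && E (u, v) || (v < u)%N && E (v, u).

Lemma edge_simple n (E : {ffun 'I_n * 'I_n -> bool}) : simple_graph (edge E).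
Proof.
split=> [u v|u]; first by rewrite /edge orbC.
by rewrite /edge ltnn.
Qed.

Lemma pairs_enum_lt n (S : {set 'I_n}) z : z \in pairs (enum S) -> (z.1 < z.2)%N.
Proof.
have : sorted (fun u v : 'I_n => (u < v)%N) (enum S).
  apply: sorted_filter; first by move=> a b c; exact: ltn_trans.
  have : sorted ltn (map val (enum 'I_n)) by rewrite val_enum_ord iota_ltn_sorted.
  by rewrite sorted_map enumT.
elim: (enum S) => //= u s IH.
rewrite path_sortedE; last by move=> a b c; exact: ltn_trans.
move=> /andP[/allP us ss]; rewrite mem_cat => /orP[/mapP[i si ->]|/IH -> //].
exact: us.
Qed.

Section RandomEdges.
Variables (R : realType) (Z : finType) (w : Z -> R).
Hypothesis w01 : forall z, 0 <= w z <= 1.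

(** The product Bernoulli measure with means [w]. *)
Definition edge_weight (E : {ffun Z -> bool}) : R :=
  \prod_z (if E z then w z else 1 - w z).

Lemma edge_weight_ge0 E : 0 <= edge_weight E.
Proof. by apply: prodr_ge0 => z _; have := w01 z; case: (E z); lra. Qed.

Lemma sum_edge_weight (P : seq Z) (F : bool -> R) : uniq P ->
  \sum_E edge_weight E * \prod_(z <- P) F (E z)
  = \prod_(z <- P) (w z * F true + (1 - w z) * F false).
Proof.
move=> uP.
have pE (G : Z -> R) : \prod_(z <- P) G z = \prod_z (if z \in P then G z else 1).
  by rewrite big_uniq // big_mkcond.
transitivity (\sum_(E : {ffun Z -> bool}) \prod_z
    ((if E z then w z else 1 - w z) * (if z \in P then F (E z) else 1))).
  by apply: eq_bigr => E _; rewrite pE -big_split.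
rewrite [RHS]pE.
rewrite -(bigA_distr_bigA (fun z b =>
  (if b then w z else 1 - w z) * (if z \in P then F b else 1))).
apply: eq_bigr => z _; rewrite big_bool /=; case: ifP => _ //; ring.
Qed.

Lemma sum_edge_weight1 : \sum_E edge_weight E = 1.
Proof.
have := @sum_edge_weight [::] (fun=> 1) isT; rewrite [RHS]big_nil => <-.
by apply: eq_bigr => E _; rewrite big_nil mulr1.
Qed.
End RandomEdges.

Lemma exists_lt1 (R : realType) (X Z : finType) (w : X -> Z -> R)
    (Q : X -> {ffun Z -> bool} -> R) :
  (forall x z, 0 <= w x z <= 1) -> (0 < #|X|)%N ->
  avg (fun x => \sum_E edge_weight (w x) E * Q x E) < 1 ->
  exists x, exists E, Q x E < 1.
Proof.
move=> w01 X0 h; apply: contrapT => H; move: h; apply/negP; rewrite -leNgt.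
rewrite -[leLHS](avg_const 1 X0); apply: ler_avg => x.
rewrite -[leLHS](sum_edge_weight1 (w x)); apply: ler_sum => E _.
rewrite ler_peMr ?edge_weight_ge0 // leNgt; apply/negP => Q1; apply: H.
by exists x, E.
Qed.

Lemma bin_le_expn n k : ('C(n, k) <= n ^ k)%N.
Proof.
apply: (@leq_trans (n ^_ k)); first by rewrite -bin_ffact leq_pmulr ?fact_gt0.
elim: k n => [|k IH] n //; rewrite ffactnS expnS leq_mul2l.
apply/orP; right; apply: leq_trans (IH _) _.
by case: k {IH} => // k; rewrite leq_exp2r // leq_pred.
Qed.

(** Choose the image in at most n^k ways, then a map into it in k^s <= s^s ways. For s = t the
    factor t^t is exp(o(t^2)). *)
Lemma card_ffun_image (n s k : nat) :
  (\sum_(v : {ffun 'I_s -> 'I_n} | #|v @: [set: 'I_s]| == k) 1 <= n ^ k * s ^ s)%N.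
Proof.
have [sk|ks] := ltnP s k.
  rewrite big_pred0 // => v; apply/negP => /eqP vk.
  by have := leq_imset_card v [set: 'I_s]; rewrite vk cardsT card_ord leqNgt sk.
apply: (@leq_trans (\sum_(A : {set 'I_n} | #|A| == k)
    \sum_(v : {ffun 'I_s -> 'I_n} | v \in ffun_on (mem A)) 1)).
  rewrite (exchange_big_dep predT) //= big_mkcond /=; apply: leq_sum => v _.
  case: ifP => // /eqP vk; rewrite (bigD1 (v @: [set: 'I_s])) //=.
  rewrite vk eqxx /=; apply/ffun_onP => i; exact: imset_f.
rewrite (eq_bigr (fun=> (k ^ s)%N)); last first.
  by move=> A /eqP Ak; rewrite sum1_card card_ffun_on card_ord; congr (_ ^ _)%N.
rewrite sum_nat_const -[X in (X * _)%N]cardsE card_draws card_ord.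
rewrite leq_mul ?bin_le_expn //.
by case: s ks => // s ks; rewrite leq_exp2r.
Qed.

Section RandomGraph.
Variables (R : realType) (n t : nat) (L : finType) (W : L -> L -> R).
Variables (Bc : R) (Bi : nat -> R).
Hypothesis t0 : (0 < t)%N.
Hypothesis L0 : (0 < #|L|)%N.
Hypothesis W01 : forall x y, 0 <= W x y <= 1.
Hypothesis Bc0 : 0 <= Bc.
Hypothesis hBc : forall s : seq 'I_n, uniq s -> size s = t ->
  avg (fun x : {ffun 'I_n -> L} => \prod_(z <- pairs s) W (x z.1) (x z.2)) <= Bc.
Hypothesis hBi : forall s : seq 'I_n, uniq s -> (size s <= t)%N ->
  avg (fun x : {ffun 'I_n -> L} => \prod_(z <- pairs s) (1 - W (x z.1) (x z.2)))
  <= Bi (size s).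
Hypothesis Bi0 : forall k, 0 < Bi k.
Hypothesis hn : n%:R ^+ t * Bc <= 1 / 4.

Let S := \sum_(k < t.+1) n%:R ^+ k * t%:R ^+ t * Bi k.

Let w (x : {ffun 'I_n -> L}) (z : 'I_n * 'I_n) := W (x z.1) (x z.2).

Let clique (E : {ffun 'I_n * 'I_n -> bool}) : R :=
  \sum_(A : {set 'I_n} | #|A| == t) \prod_(z <- pairs (enum A)) (E z)%:R.

Let indep (E : {ffun 'I_n * 'I_n -> bool}) : R :=
  \sum_(v : {ffun 'I_t -> 'I_n}) \prod_(z <- pairs (enum (v @: [set: 'I_t]))) (~~ E z)%:R.

Lemma avg_clique :
  avg (fun x => \sum_E edge_weight (w x) E * clique E) <= 1 / 4.
Proof.
apply: le_trans hn.
under eq_avg do (under eq_bigr do rewrite mulr_sumr); under eq_avg do rewrite exchange_big.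
rewrite avg_sum.
apply: (@le_trans _ _ (\sum_(A : {set 'I_n} | #|A| == t) Bc)).
  apply: ler_sum => A /eqP At.
  under eq_avg do rewrite (sum_edge_weight (w _) (fun b => b%:R)) ?uniq_pairs ?enum_uniq //.
  under eq_avg do (under eq_bigr do rewrite mulr1 mulr0 addr0).
  by apply: hBc; rewrite ?enum_uniq // -cardE.
rewrite sumr_const -[X in _ *+ X]cardsE card_draws card_ord -[_ *+ _]mulr_natl.
by rewrite ler_wpM2r // -natrX ler_nat bin_le_expn.
Qed.

(** Whether a tuple is independent depends only on its set of entries, so tuples are grouped by the
    size [k] of that set. *)
Lemma avg_indep :
  avg (fun x => \sum_E edge_weight (w x) E * indep E) <= S.
Proof.
under eq_avg do (under eq_bigr do rewrite mulr_sumr); under eq_avg do rewrite exchange_big.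
rewrite avg_sum.
have imt (v : {ffun 'I_t -> 'I_n}) : (#|v @: [set: 'I_t]| <= t)%N.
  by have := leq_imset_card v [set: 'I_t]; rewrite cardsT card_ord.
apply: (@le_trans _ _ (\sum_(v : {ffun 'I_t -> 'I_n}) Bi #|v @: [set: 'I_t]|)).
  apply: ler_sum => v _.
  under eq_avg do rewrite (sum_edge_weight (w _) (fun b => (~~ b)%:R)) ?uniq_pairs ?enum_uniq //.
  under eq_avg do (under eq_bigr do rewrite mulr1 mulr0 add0r).
  rewrite [X in Bi X]cardE; apply: hBi; rewrite ?enum_uniq // -cardE //.
rewrite (partition_big (fun v : {ffun 'I_t -> 'I_n} => inord #|v @: [set: 'I_t]| : 'I_t.+1) predT) //=.
apply: ler_sum => k _.
rewrite (eq_bigl (fun v : {ffun 'I_t -> 'I_n} => #|v @: [set: 'I_t]| == k)); last first.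
  by move=> v; rewrite -val_eqE /= inordK // ltnS.
rewrite (eq_bigr (fun=> 1%:R * Bi k)); last by move=> v /eqP ->; rewrite mul1r.
rewrite -mulr_suml -natr_sum -!natrX -natrM ler_wpM2r ?ler_nat ?card_ffun_image //.
exact: ltW.
Qed.

(** The mean of (number of cliques) + (number of independent tuples) / (2 S) is at most 1/4 + 1/2.
    Some outcome is below 1, and there the integer number of cliques vanishes. *)
Lemma random_graph : exists e : rel 'I_n,
  [/\ simple_graph e, Kt_free e t & indep_prob e t <= 2 * S / (n ^ t)%:R].
Proof.
have S0 : 0 < S.
  rewrite /S big_ord_recl; apply: ltr_pwDl.
    by rewrite !mulr_gt0 // exprn_gt0 // ltr0n.
  by apply: sumr_ge0 => k _; rewrite !mulr_ge0 ?exprn_ge0 ?ler0n // ltW.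
have [x [E QE]] : exists x : {ffun 'I_n -> L}, exists E, clique E + (2 * S)^-1 * indep E < 1.
  apply: (@exists_lt1 _ {ffun 'I_n -> L} _ w (fun _ E => clique E + (2 * S)^-1 * indep E)).
  - by move=> x z; exact: W01.
  - by rewrite card_ffun expn_gt0 L0.
  have h1 : (2 * S)^-1 * avg (fun x => \sum_E edge_weight (w x) E * indep E) <= 1 / 2.
    rewrite ler_pdivrMl ?mulr_gt0 //; have := avg_indep; lra.
  apply: (@le_lt_trans _ _ (avg (fun x => \sum_E edge_weight (w x) E * clique E)
     + (2 * S)^-1 * avg (fun x => \sum_E edge_weight (w x) E * indep E))).
    rewrite -avgZ -avgD; apply: ler_avg => x; rewrite mulr_sumr -big_split /=.
    by apply: ler_sum => E _; rewrite mulrDr mulrCA.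
  have := avg_clique; lra.
have cl0 : 0 <= clique E.
  by apply: sumr_ge0 => A _; apply: prodr_ge0 => z _; rewrite ler0n.
have in0 : 0 <= indep E.
  by apply: sumr_ge0 => v _; apply: prodr_ge0 => z _; rewrite ler0n.
have in1 : 0 <= (2 * S)^-1 * indep E by rewrite mulr_ge0 // invr_ge0 ltW // mulr_gt0.
exists (edge E); split; first exact: edge_simple.
  move=> A At; apply: contrapT => H.
  have : 1 <= clique E.
    rewrite /clique (bigD1 A) /=; last by rewrite At.
    rewrite big1_seq; last first.
      move=> z /andP[_ zA]; have zlt := pairs_enum_lt zA.
      have [z1 z2] := mem_pairs zA; rewrite !mem_enum in z1 z2.
      case Ez : (E z) => //; exfalso; apply: H; exists z.1, z.2; split => //.
        by apply/negP => /eqP zz; rewrite zz ltnn in zlt.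
      by rewrite /edge zlt ltnNge (ltnW zlt) /= orbF -surjective_pairing Ez.
    rewrite lerDl; apply: sumr_ge0 => B _; apply: prodr_ge0 => z _; exact: ler0n.
  lra.
rewrite indep_probE ler_wpM2r ?invr_ge0 ?ler0n //.
apply: (@le_trans _ _ (indep E)); first apply: ler_sum => v _.
  case: (boolP [forall i, forall j, _]) => [/forallP h|_]; last first.
    by apply: prodr_ge0 => z _; exact: ler0n.
  rewrite big1_seq // => z /andP[_ zA]; have zlt := pairs_enum_lt zA.
  have [] := mem_pairs zA; rewrite !mem_enum => /imsetP[i _ zi] /imsetP[j _ zj].
  have /forallP/(_ j) := h i; rewrite -zi -zj /edge zlt -surjective_pairing.
  by case: (E z).
have : (2 * S)^-1 * indep E < 1 by lra.
by rewrite mulrC ltr_pdivrMr ?mulr_gt0 // mul1r => /ltW.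
Qed.
End RandomGraph.

(** * The random geometric graph: cliques and independent sets *)

Lemma bin3_ge (R : realType) (k : nat) :
  (k%:R ^+ 3 - 3 * k%:R ^+ 2) / 6 <= 'C(k, 3)%:R :> R.
Proof.
rewrite ler_pdivrMr // -!natrX -!natrM.
have -> : 6%N = 3`! by [].
rewrite bin_ffact !ffactnS ffactn0 lerBlDr -natrD ler_nat.
case: k => [|[|[|k]]] //=; nia.
Qed.

Lemma gram_le (R : realType) (D : finType) (rho : R) (x y : {ffun D -> bool}) :
  0 < rho -> `|gram rho x y| <= rho * #|D|%:R.
Proof.
move=> r0; rewrite /gram normrM gtr0_norm //; apply: ler_wpM2l; first exact: ltW.
apply: le_trans (ler_norm_sum _ _ _) _.
rewrite -[#|D|%:R]sumr_const; apply: ler_sum => l _.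
by rewrite normrM /sgn; do 2 case: ifP => _; rewrite ?normrN !normr1 mulr1.
Qed.

Lemma prod_pairsZ (R : realType) (V : finType) (s : seq V) (c : R) (F : V * V -> R) :
  \prod_(z <- pairs s) (c * F z) = c ^+ 'C(size s, 2) * \prod_(z <- pairs s) F z.
Proof.
by rewrite big_split /= big_const_seq count_predT size_pairs iter_mulr_1.
Qed.

Section GraphBound.
Variables (R : realType) (r eps p : R) (Q t n : nat).
Hypotheses (hr : 1 / 2 <= r <= 1) (heps : 0 < eps <= 1 / 2) (Q8 : (8 <= Q)%N).
Hypothesis t1 : (0 < t)%N.
Hypotheses (p01 : 0 < p < 1) (pr : p = r * (1 - p)).
Local Notation q := (Q%:R : R).
Local Notation tau := (t%:R : R).

Definition gain : R := eps ^+ 3 / (6 * q).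
(** The 1 added to [slack_const] pays for the eps^4 that [linear_corr] leaves in the clique
    bound. *)
Definition slack : R := (slack_const R + 1) * eps ^+ 4 + 192 * eps ^+ 3 / q ^+ 2.

Definition clique_bound : R :=
  expR ('C(t, 2)%:R * ln p - gain * tau ^+ 2 + slack * tau ^+ 2 + 3 * tau).
Definition indep_bound (k : nat) : R :=
  expR ('C(k, 2)%:R * ln (1 - p) + gain * r ^+ 3 * k%:R ^+ 3 / tau
        + slack * tau ^+ 2 + 2 * tau).

Let q8 : 8 <= q. Proof. by rewrite (ler_nat _ 8). Qed.
Let tau1 : 1 <= tau. Proof. by rewrite (ler_nat _ 1). Qed.

Let label := {ffun 'I_((Q * t) ^ 2) -> bool}.
Let g (x y : label) : R := gram (scale R Q t) x y.
Let U1 (z : R) := kernel Q t eps ((quad1 r - 1 / 2) * eps ^+ 2)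
  (- ((1 + linear_corr r * eps ^+ 2) * eps)) (quad1 r * eps ^+ 2) z.
Let U2 (z : R) := kernel Q t eps ((quad2 r - r ^+ 2 / 2) * eps ^+ 2)
  (r * eps) (quad2 r * eps ^+ 2) z.
(** Taking the dominating weight itself as edge probability leaves only 1 - W to be bounded, and
    where the minimum is 1 that is 0. *)
Let W (x y : label) : R := Num.min 1 (p * U1 (g x y)).

Let kernel_ge0 c0 a0 b1 z : 0 <= kernel Q t eps c0 a0 b1 z.
Proof.
have [e0 _] := andP heps.
have e4 : 0 <= eps ^+ 4 by rewrite exprn_ge0 // ltW.
apply: addr_ge0 (expR_ge0 _) _; apply: mulr_ge0 (addr_ge0 (expR_ge0 _) (expR_ge0 _)).
by lra.
Qed.

Let W01 x y : 0 <= W x y <= 1.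
Proof.
have [p0 _] := andP p01.
by rewrite ge_min lexx /= le_min ler01 /= mulr_ge0 ?kernel_ge0 // ltW.
Qed.

Let W_le x y : W x y <= p * U1 (g x y).
Proof. by rewrite ge_min lexx orbT. Qed.

Let g_le x y : `|g x y| <= q * tau.
Proof.
have s0 := scale_gt0 R Q8 t1.
apply: le_trans (gram_le x y s0) _.
have -> : q * tau = (scale R Q t)^-1 by rewrite /scale invrK.
by rewrite -[leRHS]div1r ler_pdivlMr // mulrAC -expr2 scale_dim.
Qed.

(** [exponent_cover] times 1 - p: since r (1 - p) = p and (1 - p) (1 + r) = 1, it says p U1 + (1 -
    p) U2 >= 1. *)
Let one_sub_W_le x y : 1 - W x y <= (1 - p) * U2 (g x y).
Proof.
have [p0 p1] := andP p01; have [e0 e1] := andP heps; have [r0 r1] := andP hr.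
have hq8 := q8; have htau1 := tau1.
set z := g x y.
have U20 : 0 <= (1 - p) * U2 z by rewrite mulr_ge0 ?kernel_ge0 //; lra.
suff H : 1 <= p * U1 z + (1 - p) * U2 z.
  by rewrite /W -/z; case: (leP 1 (p * U1 z)); lra.
have C : 1 + r <= r * expR (exponent1 r eps z) + expR (exponent2 r eps z)
           + 600 * (1 + r) * eps ^+ 4 * expR (`|z| / 2).
  by apply: exponent_cover; apply/andP; split; lra.
have pq : (1 - p) * (1 + r) = 1 by have h := pr; lra.
(* As |g| never exceeds q * tau, the damping is at most 4 eps^4 / q times |z|. *)
have F : floor_coef Q t eps * z ^+ 2 <= `|z| / 2.
  rewrite -[z ^+ 2]real_normK ?num_real // expr2 mulrA.
  have -> : `|z| / 2 = 2^-1 * `|z| by rewrite mulrC.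
  apply: ler_wpM2r => //.
  have fc0 : 0 <= floor_coef Q t eps.
    by rewrite divr_ge0 ?mulr_ge0 ?sqr_ge0 ?exprn_ge0 ?ltW //; lra.
  apply: le_trans (ler_wpM2l fc0 (g_le x y)) _.
  have -> : floor_coef Q t eps * (q * tau) = 4 * eps ^+ 4 / q.
    by rewrite /floor_coef; field; rewrite !gt_eqF //; lra.
  rewrite ler_pdivrMr; last by lra.
  have : eps ^+ 4 <= 1 by rewrite exprn_ile1 //; lra.
  lra.
have T : expR (`|z| / 2) <= expR (z - floor_coef Q t eps * z ^+ 2)
                       + expR (- z - floor_coef Q t eps * z ^+ 2).
  have [z0|z0] := leP 0 z.
    apply: le_trans (_ : expR (z - floor_coef Q t eps * z ^+ 2) <= _).
      by rewrite ler_expR; move: F; rewrite ger0_norm //; lra.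
    by rewrite lerDl expR_ge0.
  apply: le_trans (_ : expR (- z - floor_coef Q t eps * z ^+ 2) <= _).
    by rewrite ler_expR; move: F; rewrite ltr0_norm //; lra.
  by rewrite lerDr expR_ge0.
have E1 : U1 z = expR (exponent1 r eps z) + 600 * eps ^+ 4 *
   (expR (z - floor_coef Q t eps * z ^+ 2) + expR (- z - floor_coef Q t eps * z ^+ 2)).
  by rewrite /U1 /kernel /exponent1; congr (expR _ + _); ring.
have E2 : U2 z = expR (exponent2 r eps z) + 600 * eps ^+ 4 *
   (expR (z - floor_coef Q t eps * z ^+ 2) + expR (- z - floor_coef Q t eps * z ^+ 2)).
  by rewrite /U2 /kernel /exponent2; congr (expR _ + _); ring.
have e40 : 0 <= eps ^+ 4 by rewrite exprn_ge0 // ltW.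
have e4 : 0 <= 600 * eps ^+ 4 by lra.
have T' := ler_wpM2l e4 T.
have p10 : 0 <= 1 - p by lra.
have := ler_wpM2l (_ : 0 <= 1 - p) C; rewrite pq.
have -> : (1 - p) * (r * expR (exponent1 r eps z) + expR (exponent2 r eps z)
           + 600 * (1 + r) * eps ^+ 4 * expR (`|z| / 2))
   = (r * (1 - p)) * expR (exponent1 r eps z) + (1 - p) * expR (exponent2 r eps z)
     + ((1 - p) * (1 + r)) * (600 * eps ^+ 4 * expR (`|z| / 2)) by ring.
rewrite pq -pr E1 E2 mul1r => /(_ p10) h.
clear C F T E1 E2.
move: T' h; set A := 600 * eps ^+ 4 * expR (`|z| / 2); set B := 600 * eps ^+ 4 * (_ + _).
lra.
Qed.

(** The linear coefficient is about - eps, so the triangle term is negative, and scale * eps^3 *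
    C(t,3) is gain * t^2 up to O(t). *)
Lemma avg_prod_W (s : seq 'I_n) : uniq s -> size s = t ->
  avg (fun x : {ffun 'I_n -> label} => \prod_(z <- pairs s) W (x z.1) (x z.2))
  <= clique_bound.
Proof.
move=> us st.
have [p0 p1] := andP p01; have [e0 e1] := andP heps; have [r0 r1] := andP hr.
have hq8 := q8; have htau1 := tau1.
have e2 : 0 <= eps ^+ 2 <= 1 / 4 by rewrite sqr_ge0 /=; nra.
have e20 : 0 <= eps ^+ 2 by exact: sqr_ge0.
apply: (@le_trans _ _ (avg (fun x : {ffun 'I_n -> label} => p ^+ 'C(t, 2) *
    \prod_(z <- pairs s) U1 (g (x z.1) (x z.2))))).
  apply: ler_avg => x; rewrite -st -prod_pairsZ; apply: ler_prod => z _.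
  by rewrite W_le andbT; have /andP[] := W01 (x z.1) (x z.2).
rewrite avgZ.
have s01 : 0 <= linear_corr r <= 1 / 3 by rewrite /linear_corr; have := sqr_ge0 r; nra.
have se : 0 <= linear_corr r * eps ^+ 2 <= 1 / 12.
  have [s0 s1] := andP s01; rewrite mulr_ge0 //=.
  have -> : 1 / 12 = 1 / 3 * (1 / 4) :> R by field.
  by apply: ler_pM => //; lra.
have a0e : `|- ((1 + linear_corr r * eps ^+ 2) * eps)| <= 2 * eps.
  rewrite normrN ger0_norm; last by apply: mulr_ge0; lra.
  by apply: ler_wpM2r; lra.
have b1e : eps ^+ 2 / 16 <= quad1 r * eps ^+ 2 <= eps ^+ 2.
  rewrite /quad1; apply/andP; split; nra.
have c0e : `|(quad1 r - 1 / 2) * eps ^+ 2| <= eps ^+ 2.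
  rewrite normrM (ger0_norm e20); apply: ler_piMl => //; rewrite ler_norml /quad1.
  by apply/andP; split; lra.
have st' : (size s <= t)%N by rewrite st.
have := @kernel_bound R Q t eps Q8 t1 heps _ s _ _ _ us st' a0e b1e c0e.
rewrite -/U1 -/g => K.
apply: le_trans (ler_wpM2l (_ : 0 <= p ^+ 'C(t, 2)) K) _; first by rewrite exprn_ge0 // ltW.
clear K.
rewrite -{1}(lnK (x := p)) ?posrE // -expRM_natl -expRD ler_expR st.
set C2 := 'C(t, 2)%:R; set C3 := 'C(t, 3)%:R.
have C20 : 0 <= C2 :> R by rewrite /C2.
have C2u : C2 <= tau ^+ 2 / 2 := bin2_le R t.
have C3l : (tau ^+ 3 - 3 * tau ^+ 2) / 6 <= C3 := bin3_ge R t.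
have C30 : 0 <= C3 :> R by rewrite /C3.
have h1 : C2 * ((quad1 r - 1 / 2) * eps ^+ 2 - quad1 r * eps ^+ 2
    + (- ((1 + linear_corr r * eps ^+ 2) * eps)) ^+ 2 / 2) <= eps ^+ 4 * tau ^+ 2.
  have -> : (quad1 r - 1 / 2) * eps ^+ 2 - quad1 r * eps ^+ 2
    + (- ((1 + linear_corr r * eps ^+ 2) * eps)) ^+ 2 / 2
    = eps ^+ 4 * (linear_corr r * (1 + linear_corr r * eps ^+ 2 / 2)) by field.
  have e4 : 0 <= eps ^+ 4 by rewrite exprn_ge0 // ltW.
  have w1 : linear_corr r * (1 + linear_corr r * eps ^+ 2 / 2) <= 1 / 3 * 2.
    by have [s0 s1] := andP s01; apply: ler_pM => //; lra.
  have w0 : 0 <= linear_corr r * (1 + linear_corr r * eps ^+ 2 / 2).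
    by have [s0 s1] := andP s01; apply: mulr_ge0 => //; lra.
  have w2 : eps ^+ 4 * (linear_corr r * (1 + linear_corr r * eps ^+ 2 / 2)) <= eps ^+ 4 * (1 / 3 * 2).
    exact: ler_wpM2l.
  have : C2 * (eps ^+ 4 * (linear_corr r * (1 + linear_corr r * eps ^+ 2 / 2)))
    <= tau ^+ 2 / 2 * (eps ^+ 4 * (1 / 3 * 2)).
    by apply: ler_pM => //; rewrite mulr_ge0.
  have : 0 <= eps ^+ 4 * tau ^+ 2 by rewrite mulr_ge0 ?sqr_ge0.
  lra.
have s0 := scale_gt0 R Q8 t1.
have h2 : scale R Q t * (- ((1 + linear_corr r * eps ^+ 2) * eps)) ^+ 3 * C3
    <= - gain * tau ^+ 2 + tau.
  have w1 : eps ^+ 3 <= ((1 + linear_corr r * eps ^+ 2) * eps) ^+ 3.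
    have y1 : eps <= (1 + linear_corr r * eps ^+ 2) * eps by apply: ler_peMl; lra.
    by rewrite lerXn2r ?nnegrE //; lra.
  have w2 : scale R Q t * C3 * eps ^+ 3
     <= scale R Q t * C3 * ((1 + linear_corr r * eps ^+ 2) * eps) ^+ 3.
    by apply: ler_wpM2l => //; rewrite mulr_ge0 // ltW.
  have e3 : 0 <= eps ^+ 3 <= 1.
    by apply/andP; split; [apply: exprn_ge0; lra|apply: exprn_ile1; lra].
  have w3 : scale R Q t * ((tau ^+ 3 - 3 * tau ^+ 2) / 6) * eps ^+ 3
     <= scale R Q t * C3 * eps ^+ 3.
    have [e30 _] := andP e3.
    by apply: ler_wpM2r => //; apply: ler_wpM2l => //; exact: ltW.
  have w4 : scale R Q t * ((tau ^+ 3 - 3 * tau ^+ 2) / 6) * eps ^+ 3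
     = gain * tau ^+ 2 - (eps ^+ 3 / (2 * q)) * tau.
    by rewrite /scale /gain; field; rewrite !gt_eqF //; lra.
  have w5 : eps ^+ 3 / (2 * q) * tau <= 1 * tau.
    apply: ler_wpM2r; first by lra.
    have q20 : 0 < 2 * q by lra.
    by rewrite ler_pdivrMr //; lra.
  have -> : scale R Q t * (- ((1 + linear_corr r * eps ^+ 2) * eps)) ^+ 3 * C3
    = - (scale R Q t * C3 * ((1 + linear_corr r * eps ^+ 2) * eps) ^+ 3) by ring.
  lra.
rewrite /slack; lra.
Qed.

(** The linear coefficient is r eps, so triangles now cost the fraction (r k / t)^3 of gain * t^2;
    the pair term vanishes exactly. *)
Lemma avg_prod_one_sub_W (s : seq 'I_n) : uniq s -> (size s <= t)%N ->
  avg (fun x : {ffun 'I_n -> label} => \prod_(z <- pairs s) (1 - W (x z.1) (x z.2)))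
  <= indep_bound (size s).
Proof.
move=> us st.
have [p0 p1] := andP p01; have [e0 e1] := andP heps; have [r0 r1] := andP hr.
have hq8 := q8; have htau1 := tau1.
have e20 : 0 <= eps ^+ 2 by exact: sqr_ge0.
apply: (@le_trans _ _ (avg (fun x : {ffun 'I_n -> label} => (1 - p) ^+ 'C(size s, 2) *
    \prod_(z <- pairs s) U2 (g (x z.1) (x z.2))))).
  apply: ler_avg => x; rewrite -prod_pairsZ; apply: ler_prod => z _.
  by rewrite one_sub_W_le andbT; have /andP[] := W01 (x z.1) (x z.2); lra.
rewrite avgZ.
have a0e : `|r * eps| <= 2 * eps.
  by rewrite ger0_norm ?mulr_ge0 //; [apply: ler_wpM2r; lra|lra..].
have b1e : eps ^+ 2 / 16 <= quad2 r * eps ^+ 2 <= eps ^+ 2.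
  have : 1 / 16 <= quad2 r <= 1 by rewrite /quad2; apply/andP; split; nra.
  move=> /andP[w1 w2]; rewrite ler_piMl // andbT.
  by have := ler_wpM2r e20 w1; lra.
have c0e : `|(quad2 r - r ^+ 2 / 2) * eps ^+ 2| <= eps ^+ 2.
  rewrite normrM (ger0_norm e20); apply: ler_piMl => //; rewrite ler_norml /quad2.
  by apply/andP; split; nra.
have := @kernel_bound R Q t eps Q8 t1 heps _ s _ _ _ us st a0e b1e c0e.
rewrite -/U2 -/g => K.
have p10 : 0 < 1 - p by lra.
apply: le_trans (ler_wpM2l (_ : 0 <= (1 - p) ^+ 'C(size s, 2)) K) _.
  by rewrite exprn_ge0 // ltW.
clear K; rewrite -{1}(lnK (x := 1 - p)) ?posrE // -expRM_natl -expRD ler_expR.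
have -> : (quad2 r - r ^+ 2 / 2) * eps ^+ 2 - quad2 r * eps ^+ 2 + (r * eps) ^+ 2 / 2 = 0.
  by field.
have s0 := scale_gt0 R Q8 t1.
have h2 : scale R Q t * (r * eps) ^+ 3 * 'C(size s, 3)%:R
   <= gain * r ^+ 3 * (size s)%:R ^+ 3 / tau.
  have -> : gain * r ^+ 3 * (size s)%:R ^+ 3 / tau
    = scale R Q t * (r * eps) ^+ 3 * ((size s)%:R ^+ 3 / 6).
    by rewrite /gain /scale; field; rewrite !gt_eqF //; lra.
  apply: ler_wpM2l (bin3_le R _).
  by rewrite mulr_ge0 ?ltW // exprn_gt0 // mulr_gt0 //; lra.
have h3 : 0 <= eps ^+ 4 * tau ^+ 2 by rewrite mulr_ge0 ?sqr_ge0 // exprn_ge0 // ltW.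
rewrite /slack; lra.
Qed.

Lemma graph_bound : n%:R ^+ t * clique_bound <= 1 / 4 ->
  exists e : rel 'I_n, [/\ simple_graph e, Kt_free e t &
    indep_prob e t <=
    2 * (\sum_(k < t.+1) n%:R ^+ k * tau ^+ t * indep_bound k) / (n ^ t)%:R].
Proof.
move=> h; apply: (@random_graph R n t label W clique_bound indep_bound) => //.
- by rewrite card_ffun expn_gt0 card_bool.
- exact: expR_ge0.
- exact: avg_prod_W.
- exact: avg_prod_one_sub_W.
- by move=> k; exact: expR_gt0.
Qed.
End GraphBound.

(** * The numerical criterion on (0.42, 0.5) *)

Section Numeric.
Variable R : realType.

Definition critical (p : R) : R := - ln p / (2 * - ln (1 - p)).

(** The ratio ln p / ln (1 - p) decreases in p, so a rational bound at the left end [p0] persists,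
    and there it is a comparison of integer powers. *)
Lemma ln_ratio_le (p0 p : R) (a b : nat) : 0 < p0 -> p0 <= p -> p < 1 ->
  (1 - p0) ^+ a <= p0 ^+ b -> b%:R * - ln p <= a%:R * - ln (1 - p).
Proof.
move=> p00 pp p1 h.
have p_gt0 : 0 < p by apply: lt_le_trans pp.
have q_gt0 : 0 < 1 - p by lra.
rewrite !mulrN lerN2 !mulr_natl -!lnXn // ler_ln ?posrE ?exprn_gt0 //.
apply: (@le_trans _ _ ((1 - p0) ^+ a)).
  by apply: lerXn2r; rewrite ?nnegrE; lra.
by apply: le_trans h _; apply: lerXn2r; rewrite ?nnegrE; lra.
Qed.

(* [(1 - p0)^a <= p0^b] bounds [critical] by [a / 2b] on [[p0, p1]], and [r1] bounds
   [p / (1 - p)]. *)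
Lemma criterion_interval (p0 p1 r1 p : R) (a b : nat) : (0 < b)%N ->
  0 < p0 -> p0 <= p -> p <= p1 -> p1 < 1 -> p1 <= r1 * (1 - p1) ->
  (1 - p0) ^+ a <= p0 ^+ b ->
  a%:R / (2 * b%:R) + (r1 * (a%:R / (2 * b%:R))) ^+ 3 < 1 ->
  critical p + (p / (1 - p) * critical p) ^+ 3 < 1.
Proof.
set K := a%:R / (2 * b%:R); set k := critical p.
move=> b0 p00 pp0 pp1 p11 pr1 h hK.
have p_gt0 : 0 < p by apply: lt_le_trans pp0.
have p_lt1 : p < 1 by apply: le_lt_trans p11.
have L0 : 0 < - ln p by rewrite oppr_gt0 ln_lt0 // p_gt0.
have M0 : 0 < - ln (1 - p) by rewrite oppr_gt0 ln_lt0 //; lra.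
have b0' : 0 < b%:R :> R by rewrite ltr0n.
have kK : k <= K.
  rewrite /k /K /critical ler_pdivrMr ?mulr_gt0 //.
  rewrite mulrAC ler_pdivlMr ?mulr_gt0 //.
  have := ln_ratio_le p00 pp0 p_lt1 h; lra.
have k0 : 0 <= k by rewrite divr_ge0 ?mulr_ge0 // ltW.
have rr : 0 <= p / (1 - p) <= r1.
  apply/andP; split; first by rewrite divr_ge0; lra.
  rewrite ler_pdivrMr; last by lra.
  have r10 : 0 <= r1.
    by rewrite -(pmulr_lge0 _ (_ : 0 < 1 - p1)); lra.
  have : r1 * (1 - p1) <= r1 * (1 - p) by apply: ler_wpM2l => //; lra.
  lra.
have [ra rb] := andP rr.
apply: le_lt_trans hK; apply: lerD => //.
have A0 : 0 <= p / (1 - p) * k by apply: mulr_ge0.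
have A1 : p / (1 - p) * k <= r1 * K by apply: ler_pM.
by apply: lerXn2r => //; rewrite nnegrE // (le_trans A0).
Qed.
End Numeric.

Lemma criterion (R : realType) (p : R) : 42 / 100 < p < 1 / 2 ->
  critical p + (p / (1 - p) * critical p) ^+ 3 < 1.
Proof.
move=> /andP[p0 p1].
(* The pieces use the bounds 4/5, 19/24, 10/13, 3/4 and 2/3 for [critical p]. They are shortest near
   0.42, where the left side is about 0.99. *)
have [h|h] := leP p (422 / 1000).
  by apply: (@criterion_interval R (42 / 100) (422 / 1000) (422 / 578) p 8 5);
    [by []|clear; lra|exact: ltW|exact: h|clear; lra..].
have [h1|h1] := leP p (428 / 1000).
  by apply: (@criterion_interval R (422 / 1000) (428 / 1000) (428 / 572) p 19 12);
    [by []|clear; lra|exact: ltW|exact: h1|clear; lra..].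
have [h2|h2] := leP p (44 / 100).
  by apply: (@criterion_interval R (428 / 1000) (44 / 100) (44 / 56) p 20 13);
    [by []|clear; lra|exact: ltW|exact: h2|clear; lra..].
have [h3|h3] := leP p (456 / 1000).
  by apply: (@criterion_interval R (44 / 100) (456 / 1000) (456 / 544) p 3 2);
    [by []|clear; lra|exact: ltW|exact: h3|clear; lra..].
by apply: (@criterion_interval R (456 / 1000) (1 / 2) 1 p 4 3);
  [by []|clear; lra|exact: ltW|exact: ltW|clear; lra..].
Qed.

(* The square completed in [kappa - ks] absorbs the variation of the terms in [g], so
   only their value at [kappa = ks], which is at most [- g P / 2], matters. *)
Lemma exponent_optimum (R : realType) (M ks r g kappa P zeta : R) :
  0 < M -> 0 <= ks <= 1 -> 0 <= r <= 1 -> 0 <= kappa <= 1 ->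
  P = 1 - ks - (r * ks) ^+ 3 -> 0 <= P -> zeta = P / 12 -> 0 <= g -> g <= P * M / 32 ->
  - (1 - kappa) * (M * ks + g * (1 - 2 * zeta)) - kappa ^+ 2 * M / 2
    + g * r ^+ 3 * kappa ^+ 3 + g * zeta
  <= M * ks ^+ 2 / 2 - M * ks - g * P / 2.
Proof.
move=> M0 /andP[k0 k1] /andP[r0 r1] /andP[c0 c1] PE P0 zE g0 gP.
set x := kappa - ks.
have z0 : 0 <= zeta by rewrite zE divr_ge0.
have cube : r ^+ 3 * kappa ^+ 3 - r ^+ 3 * ks ^+ 3 <= 3 * `|x|.
  have -> : r ^+ 3 * kappa ^+ 3 - r ^+ 3 * ks ^+ 3
     = r ^+ 3 * (x * (kappa ^+ 2 + kappa * ks + ks ^+ 2)) by rewrite /x; ring.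
  have r31 : 0 <= r ^+ 3 <= 1 by rewrite exprn_ge0 // exprn_ile1.
  have s3 : 0 <= kappa ^+ 2 + kappa * ks + ks ^+ 2 <= 3 by nra.
  have [ra rb] := andP r31; have [sa sb] := andP s3.
  apply: le_trans (ler_norm _) _; rewrite normrM (ger0_norm ra) normrM (ger0_norm sa).
  rewrite -[leRHS]mul1r; apply: ler_pM => //; first by rewrite mulr_ge0.
  by rewrite mulrC; apply: ler_wpM2r.
have main : 4 * g * `|x| <= M / 2 * x ^+ 2 + 8 * g ^+ 2 / M.
  rewrite -[x ^+ 2]real_normK ?num_real //.
  have : 0 <= (M * `|x| - 4 * g) ^+ 2 / (2 * M).
    by rewrite divr_ge0 ?sqr_ge0 // mulr_ge0 // ltW.
  have -> : (M * `|x| - 4 * g) ^+ 2 / (2 * M)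
    = M / 2 * `|x| ^+ 2 + 8 * g ^+ 2 / M - 4 * g * `|x| by field; rewrite gt_eqF.
  lra.
(* The bound g <= P M / 32 makes this error a quarter of g P; zeta = P / 12 makes 3 g zeta another
   quarter, and half of g P is left. *)
have g2 : 8 * g ^+ 2 / M <= g * P / 4.
  rewrite ler_pdivrMr // expr2.
  have := ler_wpM2l g0 gP; lra.
have xn : kappa <= ks + `|x| by have := ler_norm x; rewrite /x; lra.
have kz : (1 - kappa) * (2 * zeta) <= 2 * zeta.
  by rewrite ler_piMl ?mulr_ge0 //; lra.
have bracket : - (1 - kappa) * (1 - 2 * zeta) + r ^+ 3 * kappa ^+ 3 + zeta
   <= - P + 4 * `|x| + 3 * zeta.
  have : (r * ks) ^+ 3 = r ^+ 3 * ks ^+ 3 by rewrite exprMn.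
  lra.
have := ler_wpM2l g0 bracket.
have sq : - (1 - kappa) * (M * ks) - kappa ^+ 2 * M / 2
   = M * ks ^+ 2 / 2 - M * ks - M / 2 * x ^+ 2 by rewrite /x; field.
move: zE; set y := `|x| in main *; set w := x ^+ 2 in main sq *.
move=> zE hb.
have gz : g * zeta = g * P / 12 by rewrite zE; field.
set c3 := r ^+ 3 * kappa ^+ 3 in hb *.
have -> : g * r ^+ 3 * kappa ^+ 3 = g * c3 by rewrite /c3; ring.
lra.
Qed.

(** Bounds the factor t^t of the tuple count by exp(sigma t^2). *)
Lemma le_expR_large (R : realType) (sigma t : R) : 0 < sigma -> 2 / sigma ^+ 2 <= t ->
  t <= expR (sigma * t).
Proof.
move=> s0 st.
have t0 : 0 < t by apply: lt_le_trans st; rewrite divr_gt0 // exprn_gt0.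
have st0 : 0 <= sigma * t by rewrite mulr_ge0 // ltW.
apply: le_trans (expR_ge1Dxn 1 st0).
have -> : 2`!%:R = 2 :> R by [].
have : t * 2 <= (sigma * t) ^+ 2.
  rewrite exprMn expr2 [leRHS]mulrA [t * 2]mulrC; apply: ler_wpM2r; first exact: ltW.
  rewrite ler_pdivrMr ?exprn_gt0 // in st.
  by rewrite mulrC.
lra.
Qed.

Lemma c_st_le (R : realType) (n s t : nat) (e : rel 'I_n) : (0 < n)%N ->
  simple_graph e -> Kt_free e t -> c_st s t <= indep_prob e s :> R.
Proof.
move=> n0 se Ke; apply: ge_inf; last by exists n, e.
exists 0 => _ [n' [e' [_ _ _ ->]]].
by rewrite /indep_prob divr_ge0.
Qed.

Lemma natr_bin2 (R : realType) (k : nat) : 'C(k, 2)%:R = (k%:R ^+ 2 - k%:R) / 2 :> R.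
Proof.
have : ('C(k, 2) * 2 + k = k ^ 2)%N.
  have := bin_ffact k 2; rewrite (_ : 2`! = 2) // !ffactnS ffactn0 muln1 => ->.
  by case: k => //= k; rewrite -mulnSr mulnn.
move=> /(congr1 (fun m => m%:R : R)) /=; rewrite natrD natrM natrX; lra.
Qed.

(** * Exponents for large t and the choice of parameters *)

Section Asymptotics.
Variables (R : realType) (r eps p : R) (Q t : nat) (P zeta sigma : R).
Local Notation tau := (t%:R : R).
Local Notation g := (gain eps Q).
Local Notation M := (- ln (1 - p)).
Local Notation ks := (critical p).
Local Notation alpha := (M * ks + g * (1 - 2 * zeta)).
Hypotheses (hr : 1 / 2 <= r <= 1) (heps : 0 < eps <= 1 / 2) (Q8 : (8 <= Q)%N).
Hypotheses (t1 : (0 < t)%N) (p01 : 0 < p < 1) (pr : p = r * (1 - p)).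
Hypotheses (ks01 : 0 <= ks <= 1) (PE : P = 1 - ks - (r * ks) ^+ 3) (P0 : 0 <= P).
Hypotheses (zE : zeta = P / 12) (gM : g <= P * M / 32) (sl : slack eps Q <= g * zeta).
Hypothesis (st : tau <= expR (sigma * tau)).

Let tau1 : 1 <= tau. Proof. by rewrite (ler_nat _ 1). Qed.
Let M0 : 0 < M.
Proof. by have /andP[? ?] := p01; rewrite oppr_gt0 ln_lt0 //; lra. Qed.
Let g0 : 0 <= g.
Proof.
have /andP[e0 _] := heps; apply: divr_ge0; first by rewrite exprn_ge0 // ltW.
by rewrite mulr_ge0.
Qed.

(** Dividing by n^t leaves n^(k - t), and n >= exp(alpha t) / 2. With kappa = k / t the exponent is
    t^2 times the left side of [exponent_optimum], up to sigma t^2 and O(t). *)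
Lemma indep_term_bound (n k : nat) : (0 < n)%N -> (k <= t)%N ->
  expR (alpha * tau) <= 2 * n%:R ->
  n%:R ^+ k * tau ^+ t * indep_bound r eps p Q t k / n%:R ^+ t
  <= expR ((M * ks ^+ 2 / 2 - M * ks - g * P / 2 + sigma) * tau ^+ 2
           + (3 + M / 2) * tau).
Proof.
move=> n1 kt hn.
have n0 : 0 < n%:R :> R by rewrite ltr0n.
have t0 : 0 < tau by apply: lt_le_trans tau1.
have ktr : k%:R <= tau by rewrite ler_nat.
have -> : n%:R ^+ k * tau ^+ t * indep_bound r eps p Q t k / n%:R ^+ t
  = tau ^+ t * (n%:R^-1 ^+ (t - k) * indep_bound r eps p Q t k).
  have -> : n%:R ^+ t = n%:R ^+ k * n%:R ^+ (t - k) :> R by rewrite -exprD subnKC.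
  have w1 : n%:R ^+ k != 0 :> R by rewrite expf_neq0 // gt_eqF.
  have w2 : n%:R ^+ (t - k) != 0 :> R by rewrite expf_neq0 // gt_eqF.
  by rewrite exprVn; move: (indep_bound _ _ _ _ _ _) (tau ^+ t) => B T; field; apply/andP.
have h1 : tau ^+ t <= expR (sigma * tau * tau).
  rewrite [sigma * _ * _]mulrC expRM_natl.
  by apply: lerXn2r; rewrite ?nnegrE ?expR_ge0 // ltW.
have h2 : n%:R^-1 ^+ (t - k) <= expR ((tau - k%:R) * (1 - alpha * tau)).
  rewrite -natrB // expRM_natl; apply: lerXn2r; rewrite ?nnegrE ?expR_ge0 ?invr_ge0 //.
  rewrite -[leLHS]div1r ler_pdivrMr //.
  have e2 : 2 <= expR 1 :> R by have := expR_ge1Dx (1 : R); lra.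
  rewrite expRD expRN mulrAC ler_pdivlMr ?expR_gt0 // mul1r.
  apply: le_trans hn _; apply: ler_wpM2r => //; exact: ltW.
apply: (@le_trans _ _ (expR (sigma * tau * tau) *
    (expR ((tau - k%:R) * (1 - alpha * tau)) * indep_bound r eps p Q t k))).
  apply: ler_pM => //.
    by apply: mulr_ge0 (expR_ge0 _); rewrite exprn_ge0 // invr_ge0 ltW.
  by apply: ler_wpM2r => //; exact: expR_ge0.
rewrite /indep_bound -!expRD ler_expR natr_bin2.
have opt : - (1 - k%:R / tau) * alpha - (k%:R / tau) ^+ 2 * M / 2
    + g * r ^+ 3 * (k%:R / tau) ^+ 3 + g * zeta
  <= M * ks ^+ 2 / 2 - M * ks - g * P / 2.
  apply: exponent_optimum => //.
    by have /andP[? ?] := hr; apply/andP; split; lra.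
  by rewrite divr_ge0 ?ler_pdivrMr ?mul1r // ltW.
have {opt} := ler_wpM2l (sqr_ge0 tau) opt.
have -> : tau ^+ 2 * (- (1 - k%:R / tau) * alpha - (k%:R / tau) ^+ 2 * M / 2
    + g * r ^+ 3 * (k%:R / tau) ^+ 3 + g * zeta)
  = - ((tau - k%:R) * (alpha * tau)) - k%:R ^+ 2 * M / 2
    + g * r ^+ 3 * k%:R ^+ 3 / tau + g * zeta * tau ^+ 2.
  by field; rewrite gt_eqF.
have hs : slack eps Q * tau ^+ 2 <= g * zeta * tau ^+ 2.
  by apply: ler_wpM2r => //; exact: sqr_ge0.
have hk : M * k%:R <= M * tau by apply: ler_wpM2l => //; exact: ltW.
set A := g * r ^+ 3 * k%:R ^+ 3 / tau; set B := (tau - k%:R) * (alpha * tau).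
have -> : (tau - k%:R) * (1 - alpha * tau) = tau - k%:R - B by rewrite /B; ring.
set F := M * ks ^+ 2 / 2 - M * ks - g * P / 2.
have k0 : 0 <= k%:R :> R by [].
lra.
Qed.

(** M ks = - ln p / 2 cancels the edge density and g cancels the gain. Of the 2 g zeta held back in
    [alpha], one half covers [slack] and the other the O(t) terms. *)
Lemma clique_term_bound (n : nat) : (0 < n)%N ->
  n%:R <= expR (alpha * tau) ->
  - ln p = 2 * M * ks ->
  (M * ks + 5) <= g * zeta * tau ->
  n%:R ^+ t * clique_bound eps p Q t <= 1 / 4.
Proof.
move=> n1 hn Lk big; have t1' := tau1.
apply: (@le_trans _ _ (expR (tau * (alpha * tau)) * clique_bound eps p Q t)).
  apply: ler_wpM2r; first exact: expR_ge0.
  by rewrite expRM_natl; apply: lerXn2r; rewrite ?nnegrE ?expR_ge0.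
rewrite /clique_bound -expRD natr_bin2.
apply: (@le_trans _ _ (expR (- 2))).
  rewrite ler_expR.
  have hs : slack eps Q * tau ^+ 2 <= g * zeta * tau ^+ 2.
    by apply: ler_wpM2r => //; exact: sqr_ge0.
  have -> : ln p = - (2 * M * ks) by rewrite -Lk opprK.
  have := ler_wpM2r (_ : 0 <= tau) big; move=> /(_ (ler0n _ _)) big2.
  lra.
have e5 : 5 <= expR 2 :> R.
  by have := expR_ge_cubic (2 : R); lra.
rewrite expRN -[leLHS]div1r ler_pdivrMr ?expR_gt0 //; lra.
Qed.

(** The factor 2 and the t + 1 values of k cost exp(2 t). Together the lower-order terms use 2 sigma
    <= g P / 4 of the saving g P / 2. *)
Lemma c_tt_le (n : nat) : (0 < n)%N ->
  expR (alpha * tau) <= 2 * n%:R -> n%:R <= expR (alpha * tau) ->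
  - ln p = 2 * M * ks -> M * ks + 5 <= g * zeta * tau ->
  5 + M / 2 <= sigma * tau -> sigma <= g * P / 8 ->
  c_st t t <= expR ((M * ks ^+ 2 / 2 - M * ks - g * P / 4) * tau ^+ 2) :> R.
Proof.
move=> n1 hn hn' Lk big1' big2 sP; have t1' := tau1.
have [e [se Ke ie]] := @graph_bound R r eps p Q t n hr heps Q8 t1 p01 pr
  (clique_term_bound n1 hn' Lk big1').
apply: le_trans (c_st_le R t n1 se Ke) (le_trans ie _).
set F := M * ks ^+ 2 / 2 - M * ks.
rewrite -mulrA mulr_suml natrX.
apply: (@le_trans _ _ (2 * \sum_(k < t.+1)
  expR ((F - g * P / 2 + sigma) * tau ^+ 2 + (3 + M / 2) * tau))).
  apply: ler_wpM2l => //; apply: ler_sum => k _.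
  by apply: indep_term_bound => //; rewrite -ltnS.
rewrite sumr_const card_ord -[expR _ *+ _]mulr_natl.
have x1 : tau + 1 <= expR tau by rewrite addrC expR_ge1Dx.
have x2 : 2 <= expR tau by lra.
apply: (@le_trans _ _ (expR tau * (expR tau *
   expR ((F - g * P / 2 + sigma) * tau ^+ 2 + (3 + M / 2) * tau)))).
  apply: ler_pM => //.
  by apply: ler_wpM2r => //; rewrite -natr1.
rewrite -!expRD ler_expR.
have := ler_wpM2r (ler0n R t) big2.
have := ler_wpM2r (sqr_ge0 tau) sP.
lra.
Qed.
End Asymptotics.

(** Each part of [slack] gets half of gain * zeta = eps^3 zeta / (6 Q). The part 192 eps^3 / Q^2
    requires Q >= 192 * 12 / zeta, and the eps^4 part then requires eps <= zeta / (12 Q C1). *)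
Lemma choose_parameters (R : realType) (zeta B : R) : 0 < zeta -> 0 < B ->
  exists Q : nat, exists eps : R, [/\ (8 <= Q)%N, 0 < eps <= 1 / 2,
    gain eps Q <= B & slack eps Q <= gain eps Q * zeta].
Proof.
move=> z0 B0.
have [Q Q8 Qz] : exists2 Q : nat, (8 <= Q)%N & 2304 / zeta <= Q%:R.
  exists (maxn 8 (Num.trunc (2304 / zeta)).+1); first exact: leq_maxl.
  have x0 : 0 <= 2304 / zeta by apply: divr_ge0; lra.
  have /andP[_ h] := truncn_itv x0; apply: le_trans (ltW h) _.
  by rewrite ler_nat leq_maxr.
have q8 : 8 <= Q%:R :> R by rewrite (ler_nat _ 8).
have Q0 : 0 < Q%:R :> R by lra.
have [C1 C1E C10] : exists2 C1, C1 = slack_const R + 1 & 0 < C1.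
  exists (slack_const R + 1) => //.
  by have := expR_gt0 (22 : R); rewrite /slack_const; lra.
have [eps [e0 e12 eC eP]] : exists eps : R,
    [/\ 0 < eps, eps <= 1 / 2, eps <= zeta / (12 * Q%:R * C1) & eps <= B].
  exists (Num.min (1 / 2) (Num.min (zeta / (12 * Q%:R * C1)) B)).
  split; last by rewrite !ge_min lexx !orbT.
  - rewrite !lt_min B0 andbT; apply/andP; split; first by lra.
    by rewrite divr_gt0 // mulr_gt0 // mulr_gt0.
  - by rewrite ge_min lexx.
  - by rewrite !ge_min lexx orbT.
exists Q, eps.
have e30 : 0 < eps ^+ 3 by rewrite exprn_gt0.
have ge : gain eps Q <= eps.
  have e31 : eps ^+ 3 <= eps * 1.
    by rewrite exprS; apply: ler_wpM2l; [exact: ltW|apply: exprn_ile1; lra].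
  rewrite ler_pdivrMr; last by lra.
  have : eps * 1 <= eps * (6 * Q%:R) by apply: ler_wpM2l; lra.
  lra.
split => //; [by rewrite e0|exact: le_trans eP|].
have -> : gain eps Q * zeta
  = eps ^+ 3 * (zeta / (12 * Q%:R)) + eps ^+ 3 * (zeta / (12 * Q%:R)).
  by rewrite /gain; field; rewrite gt_eqF.
rewrite /slack -C1E; apply: lerD.
  have -> : C1 * eps ^+ 4 = eps ^+ 3 * (C1 * eps) by ring.
  apply: ler_wpM2l; first exact: ltW.
  have -> : zeta / (12 * Q%:R) = C1 * (zeta / (12 * Q%:R * C1)).
    by field; rewrite !gt_eqF.
  by apply: ler_wpM2l => //; exact: ltW.
have -> : 192 * eps ^+ 3 / Q%:R ^+ 2 = eps ^+ 3 * (192 / Q%:R ^+ 2).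
  by field; rewrite gt_eqF.
apply: ler_wpM2l; first exact: ltW.
rewrite ler_pdivrMr ?exprn_gt0 //.
have -> : zeta / (12 * Q%:R) * Q%:R ^+ 2 = zeta * Q%:R / 12 by field; rewrite gt_eqF.
by move: Qz; rewrite ler_pdivrMr //; lra.
Qed.

(** * Conclusion *)

Unset Implicit Arguments.
Local Open Scope classical_set_scope.

Theorem theorem1p2 (R : realType) (p : R) :
  42 / 100 < p < 1 / 2 ->
  exists gamma : R, 0 < gamma /\
  exists f : nat -> R,
    (fun t : nat => f t / (t%:R ^+ 2)) @ \oo --> 0 /\
    \forall t \near \oo,
      c_st (R := R) t t <=
      expR (((4 * ln (1 - p) - ln p) * ln p / (8 * ln (1 - p)) - gamma)
              * (t%:R ^+ 2) + f t).
Proof.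
move=> hp; have crit := criterion hp; have [p42 p12] := andP hp.
have p01 : 0 < p < 1 by apply/andP; split; lra.
have q0 : 0 < 1 - p by lra.
set r := p / (1 - p) in crit.
have hr : 1 / 2 <= r <= 1 by rewrite ler_pdivlMr // ler_pdivrMr //; lra.
have [r0 r1] := andP hr.
have pr : p = r * (1 - p) by rewrite /r mulfVK // gt_eqF.
set M := - ln (1 - p); set ks := critical p in crit.
have L0 : 0 < - ln p by rewrite oppr_gt0 ln_lt0 //.
have M0 : 0 < M by rewrite oppr_gt0 ln_lt0 //; lra.
have Lk : - ln p = 2 * M * ks.
  by rewrite /ks /critical -/M; field; rewrite gt_eqF.
have ks0 : 0 <= ks by rewrite divr_ge0 ?mulr_ge0 // ltW.
have rks0 : 0 <= (r * ks) ^+ 3 by rewrite exprn_ge0 // mulr_ge0 //; lra.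
pose P := 1 - ks - (r * ks) ^+ 3.
have P0 : 0 < P by rewrite /P; lra.
have ks01 : 0 <= ks <= 1 by apply/andP; split; lra.
clear hp p42 p12.
pose zeta := P / 12.
have z0 : 0 < zeta by rewrite divr_gt0.
have B0 : 0 < P * M / 32 by rewrite divr_gt0 // mulr_gt0.
have [Q [eps [Q8 heps gM sl]]] := choose_parameters z0 B0.
have q8 : 8 <= Q%:R :> R by rewrite (ler_nat _ 8).
have [e0 _] := andP heps.
have [g gE] : exists g, g = gain eps Q by exists (gain eps Q).
have g0 : 0 < g.
  by rewrite gE; apply: divr_gt0; [rewrite exprn_gt0|lra].
pose sigma := g * P / 8.
have s0 : 0 < sigma by rewrite divr_gt0 // mulr_gt0.
exists (g * P / 4); split; first by rewrite divr_gt0 // mulr_gt0.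
(* For large t the lower-order terms are already absorbed into [gamma], so the o(t^2) term can be
   zero. *)
exists (fun=> 0); split.
  have -> : (fun t : nat => (0 : R) / t%:R ^+ 2) = (fun=> 0).
    by apply/funext => t; rewrite mul0r.
  by move=> A /nbhs_singleton A0; exists 0%N.
(* The sum of the thresholds that [big1], [big3] and [big2] need. *)
pose X := 1 + (M * ks + 5) / (g * zeta) + 2 / sigma ^+ 2 + (5 + M / 2) / sigma.
have gz0 : 0 < g * zeta by exact: mulr_gt0.
have x1 : 0 <= (M * ks + 5) / (g * zeta).
  by apply: divr_ge0; [have := mulr_ge0 (ltW M0) ks0; lra|exact: ltW].
have x2 : 0 <= 2 / sigma ^+ 2 by rewrite divr_ge0 ?sqr_ge0.
have x3 : 0 <= (5 + M / 2) / sigma.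
  by rewrite divr_ge0 ?(ltW s0) // addr_ge0 // divr_ge0 // ltW.
exists (Num.trunc X).+1 => // t /= Xt.
have tX : X <= t%:R.
  have X0 : 0 <= X by rewrite /X; lra.
  have /andP[_ h] := truncn_itv X0; apply: le_trans (ltW h) _.
  by rewrite ler_nat.
have t1 : (0 < t)%N by apply: leq_trans Xt.
have big1 : M * ks + 5 <= g * zeta * t%:R.
  by rewrite [leRHS]mulrC -ler_pdivrMr //; rewrite /X in tX; lra.
have big2 : 5 + M / 2 <= sigma * t%:R.
  by rewrite [leRHS]mulrC -ler_pdivrMr //; rewrite /X in tX; lra.
have big3 : t%:R <= expR (sigma * t%:R).
  by apply: le_expR_large => //; rewrite /X in tX; lra.
pose alpha := M * ks + g * (1 - 2 * zeta).
have al0 : 0 <= alpha.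
  have : zeta <= 1 / 12 by rewrite /zeta /P; lra.
  have := mulr_ge0 (ltW M0) ks0.
  by move=> w1 w2; apply: addr_ge0 => //; apply: mulr_ge0; lra.
have E1 : 1 <= expR (alpha * t%:R).
  by rewrite -[leLHS]expR0 ler_expR mulr_ge0.
(* Rounding down loses at most a factor 2, because the exponential is at least 1. *)
pose n := Num.trunc (expR (alpha * t%:R)).
have /andP[n1 n2] := truncn_itv (expR_ge0 (alpha * t%:R)).
have n0 : (0 < n)%N by rewrite truncn_gt0.
have n3 : expR (alpha * t%:R) <= 2 * n%:R.
  have : 1 <= n%:R :> R by rewrite (ler_nat _ 1).
  by move: n2; rewrite -natr1 -/n; lra.
subst g.
have FE : (4 * ln (1 - p) - ln p) * ln p / (8 * ln (1 - p))
    = M * ks ^+ 2 / 2 - M * ks.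
  have -> : ln p = - (2 * M * ks) by rewrite -Lk opprK.
  have -> : ln (1 - p) = - M by rewrite /M opprK.
  by field; rewrite gt_eqF.
have H := @c_tt_le R r eps p Q t P zeta sigma hr heps Q8 t1 p01 pr ks01 erefl (ltW P0)
  erefl gM sl big3 n n0 n3 n1 Lk big1 big2 (lexx _).
by rewrite FE addr0.
Qed.
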